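(* Consider a pure branching switched network with $\boldsymbol\rho\in\mathcal C$ (where $\mathcal C$ is the interior of the convex hull of the set $\mathcal S$ of feasible schedules) and the same mean work per job required at each queue. Then the associated queueing network process $(\mathbf Q(t):t\in\mathbb Z_+)$ is positive recurrent under the MaxWeight policy, i.e. the policy which, given the queue length vector $\mathbf Q$, uses a schedule maximizing $\sum_{j\in\mathcal J}Q_j\sigma_j$ over $\boldsymbol\sigma\in\mathcal S$.
   Context: **Single class switched network.** $\mathcal J$ is a finite set of queues and time is discrete. *External arrivals.* The numbers of external arrivals per time unit at queue $j$ are $\mathbb Z_+$-valued, i.i.d. over time, independent across queues, with mean $a_j\in\mathbb R_+$. $E_j(t)$ is the total of the first $t$ of them. *Job sizes.* Job sizes at queue $j$ are geometric with parameter $p_j\in(0,1]$: each unit of service devoted to queue $j$ completes the job being served with probability $p_j$, independently. $S_j(u)$ is the number of jobs completed by $u$ units of service at queue $j$. ''The same mean work per job at each queue'' means that $p_j=p$ does not depend on $j$. *Routing.* A job completing service at $j$ moves to $j'$ with probability $P_{jj'}$ and leaves the network with probability $1-\sum_{j'}P_{jj'}$, independently of everything else. $\Phi_{jj'}(d)$ is the number of the first $d$ departures from $j$ that are routed to $j'$. The network is open: $I-\mathbf P$ is invertible, where $\mathbf P=(P_{jj'})$. *Schedules.* $\mathcal S\subset\mathbb Z_+^{|\mathcal J|}$ is a finite set of feasible schedules such that $\boldsymbol\sigma\in\mathcal S$, $\boldsymbol\sigma'\in\mathbb Z_+^{|\mathcal J|}$ and $\boldsymbol\sigma'\le\boldsymbol\sigma$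 coordinatewise imply $\boldsymbol\sigma'\in\mathcal S$. *Dynamics.* Let $\boldsymbol\pi(\mathbf Q)\in\mathcal S$ be the schedule chosen by the policy at $\mathbf Q$ (ties broken arbitrarily or randomly, depending only on $\mathbf Q$). For $t\in\mathbb N$, $Q_j(t)=Q_j(0)+A_j(t)-D_j(t)$, $A_j(t)=E_j(t)+\sum_{j'}\Phi_{j'j}(D_{j'}(t))$, $D_j(t)=S_j(\Pi_j(t))$, $\Pi_j(t)=\sum_{\tau=0}^{t-1}\big(\pi_j(\mathbf Q(\tau))\wedge Q_j(\tau)\big)$. $(\mathbf Q(t))$ is a discrete time countable state space Markov chain. *Traffic intensity.* $\lambda_j=a_j+\sum_{j'}\lambda_{j'}P_{j'j}$, $\rho_j=\lambda_j/p_j$, $\boldsymbol\rho=(\rho_j)_{j\in\mathcal J}$. **Pure branching switched network.** An open single class switched network with a single arrival stream at each queue. That is, each queue $j$ either has no preceding queue ($P_{ij}=0$ for all $i$) and receives only external arrivals, or has exactly one preceding queue $b(j)$ (the unique $i$ with $P_{ij}>0$) and receives no external arrivals. *)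

(* Defs.v *)
From HB Require Import structures.
From mathcomp Require Import all_boot all_order all_algebra finmap.
From mathcomp Require Import all_classical all_reals all_analysis.

Set Implicit Arguments.
Unset Strict Implicit.
Unset Printing Implicit Defensive.

Import Order.TTheory GRing.Theory Num.Theory.
Import numFieldNormedType.Exports.

Local Open Scope classical_set_scope.
Local Open Scope ring_scope.

Definition convex_hull (R : realType) (n : nat) (A : set 'rV[R]_n) :
  set 'rV[R]_n := smallest (@convex_set R 'rV[R]_n) A.

Definition mutually_independent (d : measure_display) (Om : measurableType d)
    (R : realType) (P : probability Om R) (I : choiceType)
    (F : I -> set (set Om)) : Prop :=
  forall (J : {fset I}) (A : I -> set Om),
    (forall i, i \in J -> F i (A i)) ->
    P (\bigcap_(i in [set` J]) A i) = (\prod_(i <- J) P (A i))%E.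

Definition identically_distributed (d d' : measure_display)
    (Om : measurableType d) (T : measurableType d') (R : realType)
    (P : probability Om R) (X Y : {RV P >-> T}) : Prop :=
  forall B, measurable B -> distribution P X B = distribution P Y B.

(* [queue_vec n] is used both for queue lengths and for schedules. *)
Notation queue_vec n := {ffun 'I_n -> nat}.

(* Where a job goes after service: [Some j'] is queue j', [None] is the
   outside of the network. *)
Definition destination (n : nat) := option 'I_n.

HB.instance Definition _ (n : nat) := Pointed.on (destination n).
HB.instance Definition _ (n : nat) :=
  @isMeasurable.Build default_measure_display (destination n)
    (@discrete_measurable (destination n)) (@discrete_measurable0 _)
    (@discrete_measurableC _) (@discrete_measurableU _).

(* The queues are 'I_n; [completion_prob j] is the geometric parameter p_j of
   the job sizes at queue j. *)
Record network (R : realType) (n : nat) := Network {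
  arrival_rate : 'rV[R]_n;
  completion_prob : 'rV[R]_n;
  routing : 'M[R]_n;
  schedules : set (queue_vec n)
}.

Record open_switched_network (R : realType) (n : nat) (N : network R n) :
    Prop := {
  arrival_rate_ge0 : forall j, 0 <= arrival_rate N 0 j;
  completion_prob_itv : forall j, 0 < completion_prob N 0 j <= 1;
  routing_ge0 : forall i j, 0 <= routing N i j;
  routing_le1 : forall i, \sum_j routing N i j <= 1;
  routing_open : 1%:M - routing N \in unitmx;
  schedules_finite : finite_set (schedules N);
  schedules_monotone : forall s s' : queue_vec n, schedules N s ->
    (forall j, (s' j <= s j)%N) -> schedules N s'
}.

Definition same_mean_work (R : realType) (n : nat) (N : network R n) : Prop :=
  forall i j, completion_prob N 0 i = completion_prob N 0 j.

Definition pure_branching (R : realType) (n : nat) (N : network R n) : Prop :=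
  forall j, (forall i, routing N i j = 0) \/
            ((exists! i, 0 < routing N i j) /\ arrival_rate N 0 j = 0).

Definition traffic_equations (R : realType) (n : nat) (N : network R n)
    (lam : 'rV[R]_n) : Prop :=
  forall j, lam 0 j = arrival_rate N 0 j + \sum_i lam 0 i * routing N i j.

Definition traffic_intensity (R : realType) (n : nat) (N : network R n)
    (lam : 'rV[R]_n) : 'rV[R]_n :=
  \row_j (lam 0 j / completion_prob N 0 j).

(* The interior is taken in the whole space R^n. *)
Definition capacity_region (R : realType) (n : nat) (N : network R n) :
    set 'rV[R]_n :=
  interior (convex_hull [set \row_j (s j)%:R | s in schedules N]).

(* The random inputs of the network:
   [ext_arrivals j t] is the number of external arrivals at j in time unit t;
   [completes j k] tells whether the k-th unit of service at j completes a job;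
   [routed j k] is the destination of the k-th departure from j;
   [seed t] is what the policy uses to break ties at time t. *)
Record inputs (d dU : measure_display) (Om : measurableType d)
    (U : measurableType dU) (R : realType) (P : probability Om R) (n : nat) :=
  Inputs {
  ext_arrivals : 'I_n -> nat -> {RV P >-> nat};
  completes : 'I_n -> nat -> {RV P >-> bool};
  routed : 'I_n -> nat -> {RV P >-> destination n};
  seed : nat -> {RV P >-> U}
}.

Variant source (n : nat) :=
  | Arrival of 'I_n & nat | Service of 'I_n & nat | Routing of 'I_n & nat
  | Seed of nat.

HB.instance Definition _ (n : nat) := gen_eqMixin (source n).
HB.instance Definition _ (n : nat) := gen_choiceMixin (source n).

Section Inputs.
Context (d dU : measure_display) (Om : measurableType d)
  (U : measurableType dU) (R : realType) (P : probability Om R) (n : nat).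
Variables (N : network R n) (X : inputs U P n).

Definition source_events (s : source n) : set (set Om) :=
  match s with
  | Arrival j t => preimage_set_system setT (ext_arrivals X j t) measurable
  | Service j k => preimage_set_system setT (completes X j k) measurable
  | Routing j k => preimage_set_system setT (routed X j k) measurable
  | Seed t => preimage_set_system setT (seed X t) measurable
  end.

Record inputs_law : Prop := {
  inputs_independent : mutually_independent P source_events;
  ext_arrivals_law : forall j t,
    identically_distributed (ext_arrivals X j t) (ext_arrivals X j 0%N);
  ext_arrivals_mean : forall j t,
    ('E_P[fun w => (ext_arrivals X j t w)%:R] = (arrival_rate N 0 j)%:E)%E;
  completes_law : forall j k,
    distribution P (completes X j k) [set true] = (completion_prob N 0 j)%:E;
  routed_law : forall j k j',
    distribution P (routed X j k) [set Some j'] = (routing N j j')%:E;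
  seed_law : forall t, identically_distributed (seed X t) (seed X 0%N)
}.

(* Deterministic policies ignore the second argument. *)
Record maxweight_policy (pol : queue_vec n -> U -> queue_vec n) : Prop := {
  policy_measurable : forall q s : queue_vec n,
    measurable [set u | pol q u = s];
  policy_feasible : forall (q : queue_vec n) (u : U), schedules N (pol q u);
  policy_maxweight : forall (q s : queue_vec n) (u : U), schedules N s ->
    (\sum_j q j * s j <= \sum_j q j * pol q u j)%N
}.

Local Open Scope nat_scope.

Definition external_arrivals (j : 'I_n) (t : nat) (w : Om) : nat :=
  \sum_(s < t) ext_arrivals X j s w.

Definition completions (j : 'I_n) (u : nat) (w : Om) : nat :=
  \sum_(k < u) completes X j k w.

Definition routed_jobs (j j' : 'I_n) (m : nat) (w : Om) : nat :=
  \sum_(k < m) (routed X j k w == Some j').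

Definition arrivals (D : queue_vec n) (j : 'I_n) (t : nat) (w : Om) : nat :=
  external_arrivals j t w + \sum_i routed_jobs i j (D i) w.

(* The queue lengths at time t, from the cumulative service [pi] given to each
   queue before t. The subtraction does not truncate, see [queue_balance]. *)
Definition queue_after (q0 : queue_vec n) (t : nat) (pi : queue_vec n)
    (w : Om) : queue_vec n :=
  let D : queue_vec n := [ffun j => completions j (pi j) w] in
  [ffun j => q0 j + arrivals D j t w - D j].

Variable pol : queue_vec n -> U -> queue_vec n.

Fixpoint service (q0 : queue_vec n) (t : nat) (w : Om) : queue_vec n :=
  if t is t'.+1 then
    let q := queue_after q0 t' (service q0 t' w) w in
    [ffun j => service q0 t' w j + minn (pol q (seed X t' w) j) (q j)]
  else [ffun=> 0].

Definition departures (q0 : queue_vec n) (t : nat) (w : Om) : queue_vec n :=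
  [ffun j => completions j (service q0 t w j) w].

Definition queue_process (q0 : queue_vec n) (t : nat) (w : Om) : queue_vec n :=
  queue_after q0 t (service q0 t w) w.

Lemma completions_addn j u v w :
  completions j (u + v) w <= completions j u w + v.
Proof.
elim: v => [|v IH]; first by rewrite !addn0.
rewrite addnS /completions big_ord_recr /= -/(completions j (u + v) w).
by rewrite addnS -addn1 leq_add // leq_b1.
Qed.

Lemma routed_jobs_mono j j' m m' w :
  m <= m' -> routed_jobs j j' m w <= routed_jobs j j' m' w.
Proof.
move=> /subnKC <-; elim: (m' - m) => [|v IH]; first by rewrite addn0.
by rewrite addnS {2}/routed_jobs big_ord_recr /= (leq_trans IH) ?leq_addr.
Qed.

Lemma completions_mono j u u' w :
  u <= u' -> completions j u w <= completions j u' w.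
Proof.
move=> /subnKC <-; elim: (u' - u) => [|v IH]; first by rewrite addn0.
by rewrite addnS {2}/completions big_ord_recr /= (leq_trans IH) ?leq_addr.
Qed.

Lemma queue_balance q0 t w j :
  queue_process q0 t w j + departures q0 t w j =
  q0 j + arrivals (departures q0 t w) j t w.
Proof.
rewrite /queue_process /queue_after ffunE -/(departures q0 t w).
rewrite subnK //; elim: t j => [|t IH] j.
  by rewrite !ffunE /completions big_ord0.
have AS : arrivals (departures q0 t w) j t w <=
          arrivals (departures q0 t.+1 w) j t.+1 w.
  rewrite /arrivals leq_add //.
    by rewrite /external_arrivals big_ord_recr leq_addr.
  apply: leq_sum => i _; apply: routed_jobs_mono.
  by rewrite !ffunE; apply: completions_mono; rewrite leq_addr.
apply: leq_trans (leq_add (leqnn (q0 j)) AS).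
rewrite {1}/departures !ffunE.
apply: leq_trans (completions_addn _ _ _ _) _.
rewrite -leq_subRL; last by move: (IH j); rewrite {1}/departures ffunE.
apply: leq_trans (geq_minr _ _) _.
exact: leqnn.
Qed.

Lemma service_sum q0 t w j :
  service q0 t w j =
  \sum_(s < t) minn (pol (queue_process q0 s w) (seed X s w) j)
                    (queue_process q0 s w j).
Proof.
elim: t => [|t IH]; first by rewrite big_ord0 ffunE.
by rewrite big_ord_recr /= ffunE -IH.
Qed.

End Inputs.

(* [Z x] is the process started from x.  The chain may be reducible, with
   transient states and several closed classes; it is positive recurrent when
   finitely many positive recurrent states, taken together, are reached in
   finite mean time from every state.  For an irreducible chain this says that
   every state is positive recurrent. *)
Section PositiveRecurrence.
Context (d : measure_display) (Om : measurableType d) (R : realType)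
  (P : probability Om R) (E : Type).
Variable Z : E -> nat -> Om -> E.

Definition return_time (x : E) (B : set E) (w : Om) : \bar R :=
  ereal_inf [set t%:R%:E | t in [set t | (0 < t)%N /\ B (Z x t w)]].

Definition mean_return_time (x : E) (B : set E) : \bar R :=
  (\int[P]_w return_time x B w)%E.

Definition positive_recurrent_state (x : E) : Prop :=
  (mean_return_time x [set x] < +oo)%E.

Definition positive_recurrent : Prop :=
  exists B : set E,
    [/\ finite_set B, (forall x, B x -> positive_recurrent_state x) &
        forall x, (mean_return_time x B < +oo)%E].

End PositiveRecurrence.

(* Main.v *)
Require Import Defs.
From HB Require Import structures.
From mathcomp Require Import all_boot all_order all_algebra finmap.
From mathcomp Require Import all_classical all_reals all_analysis.
From mathcomp Require Import measurable_realfun.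
From mathcomp Require Import ring lra zify.

Set Implicit Arguments.
Unset Strict Implicit.
Unset Printing Implicit Defensive.

Import Order.TTheory GRing.Theory Num.Theory.
Import numFieldNormedType.Exports.

Local Open Scope classical_set_scope.
Local Open Scope ring_scope.

(* Let phi(q) be the maximum of q . s over the schedules s, minus q . rho; it
   dominates a multiple of the total queue length because rho is interior.
   If y is the average service rate, the queues move along M (y - rho) with
   M x = p (x P - x), and y is a subgradient at q of the first term of phi, so
   phi moves at speed (y - rho) . M (y - rho).  In a pure branching network
   every column of P has at most one nonzero entry, which makes this form
   negative definite, and y - rho is bounded away from 0 because
   q . (y - rho) = phi(q).

   Differentiating along the trajectory is made quantitative on a window of
   length m G^k split into G-adic blocks: in the estimate over a block, the
   average service rate of its last sub-block plays the role of y, and the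
   error is controlled by the variance of the rates of the sub-blocks.  These
   variances telescope over the scales, so the errors are small on average over
   k scales.  The random inputs enter through a uniform law of large numbers,
   which needs only first moments.  This gives a negative drift of phi over a
   fixed time T, and positive recurrence follows by Foster's criterion. *)


(** * The drift of the queues *)

(** The function phi is not smooth, and the rate that is near maximal at the end of a block need not
    be the mean rate that moved the queues. Over a block the increment of phi is bounded by x . M v,
    with x the excess rate of the last sub-block and v that of the whole block. Only v . M v is
    known to be negative, and (x - v) . M v has to be paid for. The service may oscillate at any
    single scale, but squared mean rates are bounded, so the total paid over k scales stays bounded
    while k descents are counted. The last sub-block is short because near maximality degrades in
    proportion to the elapsed time; this costs 1/G per unit of time. Equal job sizes make the form a
    multiple p of x . (x P - x), for which |x P| <= |x| and the invertibility of I - P give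
    negativity. The estimate on a path is affine in the noise bound [eta], so it can be integrated
    from the mean of [eta] alone. *)

Definition drift (R : realFieldType) (n : nat) (p : R) (Pm : 'M[R]_n)
    (x : 'I_n -> R) (j : 'I_n) : R :=
  p * (\sum_i x i * Pm i j - x j).

(** * Negative definiteness of the drift form *)

Section NegativeDefinite.
Context (R : realFieldType) (n : nat) (p : R) (Pm : 'M[R]_n).
Hypothesis p_gt0 : 0 < p.
Hypothesis Pm_ge0 : forall i j, 0 <= Pm i j.
Hypothesis Pm_le1 : forall i, \sum_j Pm i j <= 1.
Hypothesis Pm_open : 1%:M - Pm \in unitmx.
Hypothesis Pm_branching : forall j i k, i != k -> Pm i j * Pm k j = 0.

(** Cross terms vanish because a column of [Pm] has at most one nonzero entry; the remaining squares
    are bounded through [Pm i j ^+ 2 <= Pm i j] and the row sums. *)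
Lemma routing_sqr_le (x : 'I_n -> R) :
  \sum_j (\sum_i x i * Pm i j) ^+ 2 <= \sum_i x i ^+ 2.
Proof.
have -> : \sum_j (\sum_i x i * Pm i j) ^+ 2 =
          \sum_j \sum_i x i ^+ 2 * Pm i j ^+ 2.
  apply: eq_bigr => j _; rewrite expr2 mulr_suml; apply: eq_bigr => i _.
  rewrite mulr_sumr (bigD1 i) //= big1 => [|k ki]; last first.
    by rewrite mulrACA Pm_branching ?mulr0 // eq_sym.
  by rewrite addr0 mulrACA -!expr2.
rewrite exchange_big /=; apply: ler_sum => i _; rewrite -mulr_sumr.
apply: ler_piMr; first exact: sqr_ge0.
apply: le_trans (Pm_le1 i); apply: ler_sum => j _.
rewrite expr2 ler_piMr //; apply: le_trans (Pm_le1 i).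
by rewrite (bigD1 j) //= lerDl sumr_ge0.
Qed.

(** With y = x P, x . y - |x|^2 = - |x - y|^2 / 2 - (|x|^2 - |y|^2) / 2, and the last bracket is
    nonnegative by [routing_sqr_le]. *)
Lemma drift_form_le (x : 'I_n -> R) :
  \sum_j x j * drift p Pm x j <=
  - (p / 2) * \sum_j (x j - \sum_i x i * Pm i j) ^+ 2.
Proof.
set y := fun j => \sum_i x i * Pm i j.
have -> : \sum_j x j * drift p Pm x j = p * (\sum_j x j * y j - \sum_j x j ^+ 2).
  rewrite -sumrB mulr_sumr; apply: eq_bigr => j _.
  by rewrite /drift /y; ring.
have -> : \sum_j (x j - y j) ^+ 2 =
          \sum_j x j ^+ 2 - 2 * \sum_j x j * y j + \sum_j y j ^+ 2.
  rewrite mulr_sumr -sumrB -big_split /=; apply: eq_bigr => j _; ring.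
have := routing_sqr_le x; rewrite -/y -subr_ge0 => /(mulr_ge0 (ltW p_gt0)).
lra.
Qed.

(** Openness enters here: x is recovered from z = x (I - P) by the inverse matrix, and
    Cauchy-Schwarz bounds its norm. *)
Lemma sqr_sum_le_inv :
  exists2 c, 0 < c & forall x : 'I_n -> R,
    \sum_j x j ^+ 2 <= c * \sum_j (x j - \sum_i x i * Pm i j) ^+ 2.
Proof.
set V := invmx (1%:M - Pm).
pose B := 1 + \sum_i \sum_j V i j ^+ 2.
have B_gt0 : 0 < B.
  rewrite ltr_pwDl // sumr_ge0 // => i _; rewrite sumr_ge0 // => j _.
  exact: sqr_ge0.
exists (n%:R * B + 1) => [|x]; first by rewrite ltr_wpDl // mulr_ge0 // ltW.
pose xv : 'rV[R]_n := \row_j x j.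
pose z := xv *m (1%:M - Pm).
have zE j : z 0 j = x j - \sum_i x i * Pm i j.
  rewrite /z mulmxBr mulmx1 !mxE; congr (_ - _).
  by apply: eq_bigr => i _; rewrite mxE.
have xE j : x j = \sum_i z 0 i * V i j.
  have -> : x j = (z *m V) 0 j by rewrite /z /V mulmxK // mxE.
  by rewrite mxE.
(* Cauchy-Schwarz against the constant vector 1, from the expansion of the double sum of squared
   differences. *)
have CS (a b : 'I_n -> R) :
    (\sum_i a i * b i) ^+ 2 <= n%:R * \sum_i (a i ^+ 2 * b i ^+ 2).
  have H : 0 <= \sum_i \sum_j (a i * b i - a j * b j) ^+ 2.
    by apply: sumr_ge0 => i _; apply: sumr_ge0 => j _; exact: sqr_ge0.
  have E : \sum_i \sum_j (a i * b i - a j * b j) ^+ 2 =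
     2 * (n%:R * \sum_i (a i ^+ 2 * b i ^+ 2) - (\sum_i a i * b i) ^+ 2).
    have nE (c : R) : n%:R * c = \sum_(j < n) c.
      by rewrite sumr_const card_ord mulr_natl.
    transitivity (\sum_i (n%:R * (a i ^+ 2 * b i ^+ 2) +
       \sum_j (a j ^+ 2 * b j ^+ 2) - 2 * (a i * b i * \sum_j (a j * b j)))).
      apply: eq_bigr => i _.
      rewrite nE !mulr_sumr -big_split -sumrB /=.
      by apply: eq_bigr => j _; rewrite /=; ring.
    rewrite sumrB big_split /= -!mulr_sumr -nE -mulr_suml; ring.
  by rewrite E in H; lra.
have S_ge0 : 0 <= \sum_i z 0 i ^+ 2 by apply: sumr_ge0 => i _; exact: sqr_ge0.
have -> : \sum_j (x j - \sum_i x i * Pm i j) ^+ 2 = \sum_j z 0 j ^+ 2.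
  by apply: eq_bigr => j _; rewrite zE.
apply: (@le_trans _ _ (n%:R * B * \sum_i z 0 i ^+ 2)); last first.
  by apply: ler_wpM2r => //; rewrite lerDl.
have -> : \sum_j x j ^+ 2 = \sum_j (\sum_i z 0 i * V i j) ^+ 2.
  by apply: eq_bigr => j _; rewrite -xE.
apply: (@le_trans _ _ (n%:R * \sum_i \sum_j (z 0 i ^+ 2 * V i j ^+ 2))).
  rewrite exchange_big mulr_sumr /=; apply: ler_sum => j _; exact: CS.
rewrite -mulrA; apply: ler_wpM2l => //; rewrite mulr_sumr.
apply: ler_sum => i _; rewrite -mulr_sumr mulrC.
apply: ler_wpM2r; first exact: sqr_ge0.
rewrite /B [X in _ <= _ + X](bigD1 i) //= [leRHS]addrC -[leRHS]addrA lerDl addr_ge0 //.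
rewrite sumr_ge0 // => k _.
by apply: sumr_ge0 => j _; exact: sqr_ge0.
Qed.

Lemma drift_negative_definite :
  exists2 mu, 0 < mu & forall x : 'I_n -> R,
    \sum_j x j * drift p Pm x j <= - mu * \sum_j x j ^+ 2.
Proof.
have [c c0 Hc] := sqr_sum_le_inv.
exists (p / 2 / c) => [|x]; first by rewrite !divr_gt0.
apply: le_trans (drift_form_le x) _.
have := Hc x; set A := \sum_j x j ^+ 2; set B := \sum_j _ => HAB.
rewrite !mulNr lerN2 -(mulrA (p / 2)); apply: ler_wpM2l; first by rewrite divr_ge0 // ltW.
by rewrite ler_pdivrMl.
Qed.
End NegativeDefinite.

(** * Descent of the potential along a fixed trajectory *)

Section Trajectory.
Context (R : realFieldType) (n : nat) (p : R) (Pm : 'M[R]_n).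
Variables (rho : 'I_n -> R) (mu K : R).
Hypothesis p_itv : 0 <= p <= 1.
Hypothesis Pm_itv : forall i j, 0 <= Pm i j <= 1.
Hypothesis rho_itv : forall j, 0 <= rho j <= K.
Hypothesis K_ge0 : 0 <= K.
Hypothesis mu_ge0 : 0 <= mu.
Hypothesis drift_neg : forall x : 'I_n -> R,
  \sum_j x j * drift p Pm x j <= - mu * \sum_j x j ^+ 2.

Variables (e Q : nat -> 'I_n -> R) (h : nat -> R) (T : nat) (eta : R).

(** One sample path is fixed: [e] is the service given, [Q] the queue lengths, [h] the maximal
    weight and [eta] a bound on the noise up to time [T]. The slack [K] in [e_maximal] accounts for
    schedules truncated by the queue lengths. *)
Definition excess (t : nat) (j : 'I_n) : R := \sum_(s < t) (e s j - rho j).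
Let Psi := excess.

Hypothesis e_itv : forall t j, 0 <= e t j <= K.
Hypothesis e_feasible : forall t t', \sum_j e t j * Q t' j <= h t'.
Hypothesis e_maximal : forall t, h t <= \sum_j e t j * Q t j + K.
Hypothesis eta_ge0 : 0 <= eta.
Hypothesis Q_drift : forall t j, (t <= T)%N ->
  `|Q t j - (Q 0%N j + drift p Pm (Psi t) j)| <= eta.

Let f t := h t - \sum_j rho j * Q t j.

Lemma driftB (x y : 'I_n -> R) j :
  drift p Pm (fun j => x j - y j) j = drift p Pm x j - drift p Pm y j.
Proof.
rewrite /drift; under eq_bigr do rewrite mulrBl.
by rewrite sumrB; ring.
Qed.

Lemma driftZ c (x : 'I_n -> R) j :
  drift p Pm (fun j => c * x j) j = c * drift p Pm x j.
Proof.
rewrite /drift; under eq_bigr do rewrite -mulrA.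
by rewrite -mulr_sumr; ring.
Qed.

Lemma drift_bound (x : 'I_n -> R) b j : (forall j, `|x j| <= b) ->
  `|drift p Pm x j| <= (n%:R + 1) * b.
Proof.
move=> xb; rewrite /drift normrM.
have b0 : 0 <= b by apply: le_trans (xb j).
have [p0 p1] := andP p_itv.
apply: (@le_trans _ _ `|\sum_i x i * Pm i j - x j|).
  by apply: ler_piMl => //; rewrite ger0_norm.
apply: le_trans (ler_normB _ _) _; rewrite mulrDl mul1r lerD //.
apply: le_trans (ler_norm_sum _ _ _) _.
rewrite mulr_natl -[n in _ *+ n]card_ord -sumr_const; apply: ler_sum => i _.
have [P0 P1] := andP (Pm_itv i j).
rewrite normrM (ger0_norm P0).
exact: le_trans (ler_piMr (normr_ge0 _) P1) (xb i).
Qed.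

Lemma excess_lip t l j : `|Psi (t + l) j - Psi t j| <= K * l%:R.
Proof.
have -> : Psi (t + l) j - Psi t j = \sum_(s < l) (e (t + s)%N j - rho j).
  by rewrite /Psi /excess big_split_ord /= [X in X - _]addrC addrK.
apply: le_trans (ler_norm_sum _ _ _) _.
rewrite mulr_natr -[l in _ *+ l]card_ord -sumr_const; apply: ler_sum => i _.
have /andP[? ?] := e_itv (t + i) j; have /andP[? ?] := rho_itv j.
by rewrite ler_norml; apply/andP; split; lra.
Qed.

Lemma queue_increment s l j : (s + l <= T)%N ->
  `|Q (s + l)%N j - Q s j
     - drift p Pm (fun j => Psi (s + l) j - Psi s j) j| <= 2 * eta.
Proof.
move=> slT; have := Q_drift j slT.
have := Q_drift j (leq_trans (leq_addr l s) slT).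
rewrite driftB !ler_norml => /andP[? ?] /andP[? ?].
by apply/andP; split; lra.
Qed.

Lemma queue_lip s l j : (s + l <= T)%N ->
  `|Q (s + l)%N j - Q s j| <= (n%:R + 1) * (K * l%:R) + 2 * eta.
Proof.
move=> slT; have := queue_increment j slT.
have := drift_bound j (fun j => excess_lip s l j).
rewrite !ler_norml => /andP[? ?] /andP[? ?].
by apply/andP; split; lra.
Qed.

(** The rate e(s) is near maximal at Q(s), where e(s+l) is feasible; each passage between Q(s) and
    Q(s+l) costs at most n K times the distance moved. *)
Lemma e_near_maximal s l : (s + l <= T)%N ->
  h (s + l)%N <= \sum_j e s j * Q (s + l)%N j +
    (2 * K + 2 * (n%:R * (K * ((n%:R + 1) * (K * l%:R) + 2 * eta)))).
Proof.
move=> slT; set D := (n%:R + 1) * (K * l%:R) + 2 * eta.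
(* The boolean selects the direction in which Q(s) and Q(s+l) are exchanged. *)
have pair t (b : bool) : \sum_j e t j * Q (if b then s + l else s)%N j <=
   \sum_j e t j * Q (if b then s else s + l)%N j + n%:R * (K * D).
  rewrite mulr_natl -[n in _ *+ n]card_ord -sumr_const -big_split /=.
  apply: ler_sum => j _; have /andP[e0 eK] := e_itv t j.
  rewrite -lerBlDl -mulrBr; apply: le_trans (ler_norm _) _.
  rewrite normrM (ger0_norm e0); apply: ler_pM => //.
  by case: b; [|rewrite distrC]; exact: queue_lip.
have := e_maximal (s + l); have := pair (s + l)%N true.
have := e_feasible (s + l) s; have := e_maximal s; have := pair s false.
by rewrite /=; lra.
Qed.

(** Collects the errors of a block in units of [l + eta + 1]: the slack of maximality taken twice,
    two displacements of the queues paired with a rate, and the noise of a queue increment. *)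
Definition block_cost : R :=
  2 * K + 2 * (n%:R * (K * ((n%:R + 1) * K + 2))) + 2 * (n%:R * K).

Lemma block_cost_ge0 : 0 <= block_cost.
Proof. by rewrite !(addr_ge0, mulr_ge0). Qed.

Lemma last_block_optimal s l : (s + l <= T)%N ->
  l%:R * h (s + l)%N <= \sum_j (\sum_(i < l) e (s + i)%N j) * Q (s + l)%N j +
    l%:R * (2 * K + 2 * (n%:R * (K * ((n%:R + 1) * (K * l%:R) + 2 * eta)))).
Proof.
move=> slT; set D := 2 * K + _.
have -> : \sum_j (\sum_(i < l) e (s + i)%N j) * Q (s + l)%N j =
          \sum_(i < l) \sum_j e (s + i)%N j * Q (s + l)%N j.
  by rewrite exchange_big; apply: eq_bigr => j _; rewrite mulr_suml.
have lE (c : R) : l%:R * c = \sum_(i < l) c.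
  by rewrite sumr_const card_ord mulr_natl.
rewrite !lE -big_split; apply: ler_sum => i _ /=.
have E : (s + l = s + i + (l - i))%N by rewrite -addnA subnKC // ltnW.
have := @e_near_maximal (s + i) (l - i); rewrite -E => /(_ slT).
move/le_trans; apply; rewrite lerD2l /D lerD2l ler_wpM2l // ler_wpM2l //.
rewrite ler_wpM2l // lerD2r ler_wpM2l ?addr_ge0 // ler_wpM2l // ler_nat.
exact: leq_subr.
Qed.

(** Convexity: the mean service y of the last sub-block is near maximal at the end and feasible at
    the start, hence an approximate subgradient, h(t) - h(s) <= y . (Q(t) - Q(s)) + error. The queue
    increment is, up to noise, the drift of the excess over the whole block. *)
Lemma potential_increment s l1 l : (0 < l)%N -> (s + l1 + l <= T)%N ->
  f (s + l1 + l)%N - f s <=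
  \sum_j ((Psi (s + l1 + l)%N j - Psi (s + l1)%N j) / l%:R) *
     drift p Pm (fun j => Psi (s + l1 + l)%N j - Psi s j) j +
  block_cost * (l%:R + eta + 1).
Proof.
move=> l0 slT; set t := (s + l1 + l)%N.
pose x j := (Psi t j - Psi (s + l1)%N j) / l%:R.
have lR : 0 < l%:R :> R by rewrite ltr0n.
have eE j : \sum_(i < l) e (s + l1 + i)%N j = l%:R * (x j + rho j).
  rewrite /x mulrDr mulrCA mulfV ?gt_eqF // mulr1.
  rewrite /Psi /excess big_split_ord /= [X in X - _]addrC addrK sumrB.
  by rewrite sumr_const card_ord mulr_natl subrK.
have up : h t <= \sum_j (x j + rho j) * Q t j +
    (2 * K + 2 * (n%:R * (K * ((n%:R + 1) * (K * l%:R) + 2 * eta)))).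
  have := last_block_optimal slT; under eq_bigr do rewrite eE -mulrA.
  by rewrite -mulr_sumr -mulrDr ler_pM2l.
have lo : \sum_j (x j + rho j) * Q s j <= h s.
  rewrite -(ler_pM2l lR) mulr_sumr.
  have -> : l%:R * h s = \sum_(i < l) h s by rewrite sumr_const card_ord mulr_natl.
  have -> : \sum_j l%:R * ((x j + rho j) * Q s j) =
            \sum_(i < l) \sum_j e (s + l1 + i)%N j * Q s j.
    rewrite exchange_big; apply: eq_bigr => j _.
    by rewrite mulrA -eE mulr_suml.
  by apply: ler_sum => i _; exact: e_feasible.
have xK j : `|x j| <= K.
  rewrite /x normrM normfV (ger0_norm (ltW lR)) ler_pdivrMr //.
  exact: excess_lip.
have tT : (s + (l1 + l) <= T)%N by rewrite addnA.
have step : \sum_j x j * (Q t j - Q s j) <=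
  \sum_j x j * drift p Pm (fun j => Psi t j - Psi s j) j + n%:R * (K * (2 * eta)).
  rewrite mulr_natl -[n in _ *+ n]card_ord -sumr_const -big_split /=.
  apply: ler_sum => j _; rewrite -lerBlDl -mulrBr.
  apply: le_trans (ler_norm _) _; rewrite normrM; apply: ler_pM => //.
  by have := queue_increment j tT; rewrite /t -addnA.
have E : f t - f s = h t - h s - \sum_j rho j * Q t j + \sum_j rho j * Q s j.
  by rewrite /f; ring.
rewrite E.
have E2 q : \sum_j (x j + rho j) * Q q j =
   \sum_j x j * Q q j + \sum_j rho j * Q q j.
  by rewrite -big_split; apply: eq_bigr => j _ /=; rewrite mulrDl.
have E3 : \sum_j x j * (Q t j - Q s j) =
          \sum_j x j * Q t j - \sum_j x j * Q s j.
  by rewrite -sumrB; apply: eq_bigr => j _; rewrite mulrBr.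
rewrite E2 in up; rewrite E2 in lo; rewrite E3 in step.
have nK : 0 <= n%:R * K by rewrite mulr_ge0.
have nnK2 : 0 <= n%:R * (K * ((n%:R + 1) * K)) by rewrite !mulr_ge0 ?addr_ge0.
have ? := mulr_ge0 nK eta_ge0; have ? := mulr_ge0 nK (ltW lR).
have ? := mulr_ge0 nnK2 eta_ge0; have ? := mulr_ge0 K_ge0 (ltW lR).
have ? := mulr_ge0 K_ge0 eta_ge0.
rewrite /block_cost -/(x _); lra.
Qed.

(** Later rates are tested on the initial queues; this is what bounds the energy from below. *)
Lemma e_initially_near_maximal t : (t <= T)%N ->
  h 0%N <= \sum_j e t j * Q 0%N j + block_cost * (T%:R + eta + 1).
Proof.
move=> tT; set D := (n%:R + 1) * (K * t%:R) + 2 * eta.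
have pair (b : bool) : \sum_j e (if b then 0 else t)%N j * Q (if b then 0 else t)%N j <=
    \sum_j e (if b then 0 else t)%N j * Q (if b then t else 0)%N j + n%:R * (K * D).
  rewrite mulr_natl -[n in _ *+ n]card_ord -sumr_const -big_split /=.
  apply: ler_sum => j _; have /andP[e0 eK] := e_itv (if b then 0 else t)%N j.
  rewrite -lerBlDl -mulrBr; apply: le_trans (ler_norm _) _.
  rewrite normrM (ger0_norm e0); apply: ler_pM => //.
  have := @queue_lip 0 t j tT; rewrite add0n => H.
  by case: b {e0 eK} => //; rewrite distrC.
have nK : 0 <= n%:R * K by rewrite mulr_ge0.
have nnK2 : 0 <= n%:R * (K * ((n%:R + 1) * K)) by rewrite !mulr_ge0 ?addr_ge0.
have tTR : t%:R <= T%:R :> R by rewrite ler_nat.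
have DT : n%:R * (K * D) <= n%:R * (K * ((n%:R + 1) * (K * T%:R) + 2 * eta)).
  rewrite ler_wpM2l // ler_wpM2l // lerD2r ler_wpM2l ?addr_ge0 //.
  by rewrite ler_wpM2l.
have ? := mulr_ge0 nK eta_ge0; have ? := mulr_ge0 nK (ler0n R T).
have ? := mulr_ge0 nnK2 eta_ge0; have ? := mulr_ge0 K_ge0 (ler0n R T).
have ? := mulr_ge0 K_ge0 eta_ge0.
have := e_maximal 0; have := pair true; have := e_feasible 0 t.
have := e_maximal t; have := pair false; rewrite /block_cost /=; lra.
Qed.

(* [l] times the squared norm of the mean of [e - rho] over the block. *)
Definition energy (s l : nat) : R :=
  \sum_j (Psi (s + l)%N j - Psi s j) ^+ 2 / l%:R.

Lemma energy_upper s l : energy s l <= n%:R * K ^+ 2 * l%:R.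
Proof.
rewrite -mulrA mulr_natl -[n in _ *+ n]card_ord -sumr_const.
(* For [l = 0] the inverse is 0 by convention and both sides vanish. *)
apply: ler_sum => j _; case: l => [|l]; first by rewrite invr0 !mulr0.
rewrite ler_pdivrMr ?ltr0n // -mulrA -expr2 -exprMn.
by rewrite -real_normK ?num_real // ler_pXn2r // ?nnegrE ?mulr_ge0 // excess_lip.
Qed.

(** Every rate of the window is near maximal at Q(0), so the mean v of e - rho over any block
    satisfies Q(0) . v >= eps X - error with X the total of Q(0); hence |v| cannot be much below
    eps. *)
Lemma energy_lower eps s l : (0 < l)%N -> (s + l <= T)%N -> 0 < eps ->
  (forall j, 0 <= Q 0%N j) -> 0 < \sum_j Q 0%N j ->
  eps * \sum_j Q 0%N j <= f 0%N ->
  l%:R * (eps ^+ 2 -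
    2 * eps * (block_cost * (T%:R + eta + 1)) / \sum_j Q 0%N j) <= energy s l.
Proof.
move=> l0 slT eps0 Q0; set X := \sum_j _ => X0 Xf.
set B := block_cost * _.
have lR : 0 < l%:R :> R by rewrite ltr0n.
pose v j := (Psi (s + l) j - Psi s j) / l%:R.
pose E := \sum_j v j ^+ 2.
have -> : energy s l = l%:R * E.
  rewrite mulr_sumr; apply: eq_bigr => j _.
  by rewrite /v exprMn expr2 exprVn; field; rewrite gt_eqF.
rewrite ler_pM2l //.
(* From (v_j - eps)^2 >= 0: v_j <= (v_j^2 + eps^2) / (2 eps), which is linear in [E]. *)
have up : \sum_j v j * Q 0%N j <= X * (E / (2 * eps) + eps / 2).
  rewrite mulr_suml; apply: ler_sum => j _; rewrite mulrC; apply: ler_wpM2l => //.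
  have vE : v j ^+ 2 <= E.
    by rewrite /E (bigD1 j) //= lerDl sumr_ge0 // => i _; exact: sqr_ge0.
  have -> : E / (2 * eps) + eps / 2 = (E + eps ^+ 2) / (2 * eps).
    by field; rewrite gt_eqF.
  rewrite ler_pdivlMr ?mulr_gt0 //.
  have := sqr_ge0 (v j - eps); lra.
have lo : eps * X - B <= \sum_j v j * Q 0%N j.
  rewrite -(ler_pM2l lR) [leRHS]mulr_sumr.
  have -> : \sum_j l%:R * (v j * Q 0%N j) =
      \sum_(i < l) \sum_j (e (s + i)%N j - rho j) * Q 0%N j.
    rewrite exchange_big; apply: eq_bigr => j _.
    rewrite -mulr_suml mulrA /v mulrCA mulfV ?gt_eqF // mulr1; congr (_ * _).
    by rewrite /Psi /excess big_split_ord /= [X in X - _]addrC addrK.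
  rewrite mulr_natl -[l in _ *+ l]card_ord -sumr_const; apply: ler_sum => i _.
  have siT : (s + i <= T)%N.
    by apply: leq_trans slT; rewrite leq_add2l ltnW.
  have := e_initially_near_maximal siT; rewrite -/B.
  have -> : \sum_j (e (s + i)%N j - rho j) * Q 0%N j =
    \sum_j e (s + i)%N j * Q 0%N j - \sum_j rho j * Q 0%N j.
    by rewrite -sumrB; apply: eq_bigr => j _; rewrite mulrBl.
  by move: Xf; rewrite /f; lra.
have := le_trans lo up.
have -> : X * (E / (2 * eps) + eps / 2) =
  (X / (2 * eps)) * (E + eps ^+ 2) by field; rewrite gt_eqF.
have -> : eps * X - B =
  (X / (2 * eps)) * (2 * eps ^+ 2 - 2 * eps * B / X).
  by field; rewrite !gt_eqF.
rewrite ler_pM2l ?divr_gt0 ?mulr_gt0 //; lra.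
Qed.

(** Variance identity for the rates of the [g.+1] sub-blocks: mean of the squares minus square of
    the mean. The last sub-block is a single term of the sum, which is where the factor [g.+1] is
    lost. *)
Lemma sqr_last_le_energy (g l s : nat) : (0 < l)%N ->
  (g.+1 * l)%N%:R * \sum_j
    ((Psi (s + g * l + l)%N j - Psi (s + g * l)%N j) / l%:R -
     (Psi (s + g * l + l)%N j - Psi s j) / (g.+1 * l)%N%:R) ^+ 2 <=
  g.+1%:R * (\sum_(r < g.+1) energy (s + r * l) l - energy s (g.+1 * l)).
Proof.
move=> l0; have lR : 0 < l%:R :> R by rewrite ltr0n.
have gR : 0 < g.+1%:R :> R by rewrite ltr0n.
rewrite /energy exchange_big -sumrB !mulr_sumr; apply: ler_sum => j _ /=.
pose d r := Psi (s + r * l + l)%N j - Psi (s + r * l)%N j.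
have tE : (s + g * l + l = s + g.+1 * l)%N by rewrite mulSn -addnA (addnC l).
have DE : Psi (s + g.+1 * l)%N j - Psi s j = \sum_(r < g.+1) d r.
  rewrite -(big_mkord xpredT d).
  rewrite (eq_bigr (fun r => Psi (s + r.+1 * l)%N j - Psi (s + r * l)%N j)).
    by rewrite (telescope_sumr (fun r => Psi (s + r * l)%N j)) // mul0n addn0.
  by move=> r _; rewrite /d mulSn -addnA (addnC l).
rewrite -/(d g) tE DE natrM; set D := \sum_(r < _) _.
set L := l%:R; set G := g.+1%:R.
apply: (@le_trans _ _ (G * L * \sum_(r < g.+1) (d r / L - D / (G * L)) ^+ 2)).
  apply: ler_wpM2l; first by rewrite mulr_ge0 ?ltW.
  rewrite [leRHS]big_ord_recr /= lerDr sumr_ge0 // => r _.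
  exact: sqr_ge0.
rewrite le_eqVlt; apply/orP; left; apply/eqP.
have sqrE (z D' G' L' : R) : G' != 0 -> L' != 0 -> (z / L' - D' / (G' * L')) ^+ 2 =
    L'^-1 * (z ^+ 2 / L') - 2 * D' / (G' * L' ^+ 2) * z
      + D' ^+ 2 / (G' ^+ 2 * L' ^+ 2).
  by move=> G0 L0; field; rewrite G0 L0.
have -> : \sum_(r < g.+1) (d r / L - D / (G * L)) ^+ 2 =
    \sum_(r < g.+1) (L^-1 * (d r ^+ 2 / L) - 2 * D / (G * L ^+ 2) * d r
      + D ^+ 2 / (G ^+ 2 * L ^+ 2)).
  by apply: eq_bigr => r _; apply: sqrE; rewrite gt_eqF.
rewrite big_split sumrB -!mulr_sumr -/D sumr_const card_ord /=.
rewrite -(mulr_natl (G ^+ 2 * L ^+ 2)^-1) -/G.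
rewrite -[X in _ = G * (X - _)]/(\sum_(r < g.+1) d r ^+ 2 / L).
have idE (S D' G' L' : R) : G' != 0 -> L' != 0 ->
    G' * L' * (L'^-1 * S - 2 * D' / (G' * L' ^+ 2) * D' +
      D' ^+ 2 * (G' / (G' ^+ 2 * L' ^+ 2))) = G' * (S - D' ^+ 2 / (G' * L')).
  by move=> G0 L0; field; rewrite G0 L0.
by rewrite idE ?gt_eqF.
Qed.

(** Write x . M v = v . M v + (x - v) . M v. The first term is controlled by negative definiteness;
    in the second, M v is bounded and |z| <= delta + z^2 / delta turns x - v into the variance of
    [sqr_last_le_energy]. *)
Lemma block_step (g l s : nat) delta : (0 < l)%N -> (s + g.+1 * l <= T)%N ->
  0 < delta ->
  f (s + g.+1 * l)%N - f s <= - mu * energy s (g.+1 * l) +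
    (n%:R + 1) * K * (n%:R * delta * (g.+1 * l)%N%:R + g.+1%:R / delta *
      (\sum_(r < g.+1) energy (s + r * l) l - energy s (g.+1 * l))) +
    block_cost * (l%:R + eta + 1).
Proof.
move=> l0; have tE : (s + g.+1 * l = s + g * l + l)%N.
  by rewrite mulSn -addnA (addnC l).
rewrite {1 2}tE => slT delta0.
apply: le_trans (potential_increment l0 slT) _; rewrite lerD2r.
have lR : 0 < l%:R :> R by rewrite ltr0n.
set L : R := (g.+1 * l)%N%:R.
have LR : 0 < L by rewrite /L ltr0n muln_gt0.
set t := (s + g * l + l)%N.
pose x j := (Psi t j - Psi (s + g * l)%N j) / l%:R.
pose v j := (Psi t j - Psi s j) / L.
have dE j : drift p Pm (fun j => Psi t j - Psi s j) j = L * drift p Pm v j.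
  rewrite -driftZ /drift /v; congr (p * (_ - _)); last first.
    by rewrite mulrC divfK ?gt_eqF.
  by apply: eq_bigr => i _; rewrite mulrCA mulfV ?gt_eqF // mulr1.
have vK j : `|v j| <= K.
  rewrite /v normrM normfV (ger0_norm (ltW LR)) ler_pdivrMr //.
  by rewrite /L /t -tE; exact: excess_lip.
have EE : energy s (g.+1 * l) = L * \sum_j v j ^+ 2.
  rewrite mulr_sumr; apply: eq_bigr => j _; rewrite tE -/t -/L.
  by rewrite /v expr_div_n mulrCA [L ^+ 2]expr2 invfM mulVKf ?gt_eqF.
have main : \sum_j x j * drift p Pm v j <= - mu * \sum_j v j ^+ 2 +
    (n%:R + 1) * K * (n%:R * delta + (\sum_j (x j - v j) ^+ 2) / delta).
  have -> : \sum_j x j * drift p Pm v j = \sum_j v j * drift p Pm v j +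
      \sum_j (x j - v j) * drift p Pm v j.
    by rewrite -big_split; apply: eq_bigr => j _ /=; ring.
  apply: lerD => //.
  have -> : n%:R * delta = \sum_(j < n) delta.
    by rewrite sumr_const card_ord mulr_natl.
  rewrite mulr_suml -big_split mulr_sumr; apply: ler_sum => j _ /=.
  apply: le_trans (ler_norm _) _; rewrite normrM mulrC.
  apply: ler_pM => //; first exact: drift_bound.
  rewrite -real_normK ?num_real //; set z := `|_|.
  rewrite -(ler_pM2r delta0) mulrDl divfK ?gt_eqF //.
  have := sqr_ge0 (z - delta); have : 0 <= z by rewrite /z.
  nra.
have -> : \sum_j (Psi t j - Psi (s + g * l)%N j) / l%:R *
    drift p Pm (fun j => Psi t j - Psi s j) j = L * \sum_j x j * drift p Pm v j.
  by rewrite mulr_sumr; apply: eq_bigr => j _; rewrite dE mulrCA.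
have := sqr_last_le_energy g s l0; rewrite -/L -/t -/(x _) -/(v _) => sq.
apply: le_trans (_ : L * (- mu * \sum_j v j ^+ 2 + (n%:R + 1) * K *
    (n%:R * delta + (\sum_j (x j - v j) ^+ 2) / delta)) <= _).
  by rewrite ler_pM2l.
rewrite mulrDr mulrCA -EE lerD2l mulrCA; apply: ler_wpM2l.
  by rewrite mulr_ge0 ?addr_ge0.
rewrite mulrDr mulrC lerD2l mulrA -mulrA -[leRHS]mulrA [_^-1 * _]mulrC mulrA.
by rewrite [leRHS]mulrA ler_pM2r ?invr_gt0.
Qed.

(* The energy lost at each refinement telescopes, so that [i] scales cost no more
   than one. *)
Lemma multiscale_descent (g m : nat) kappa A : 0 <= A -> (0 < m)%N ->
  (forall l s, (m <= l)%N -> (s + g.+1 * l <= T)%N ->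
     f (s + g.+1 * l)%N - f s <= kappa * (g.+1 * l)%N%:R +
       A * (\sum_(r < g.+1) energy (s + r * l) l - energy s (g.+1 * l))) ->
  forall i s, (s + m * g.+1 ^ i <= T)%N ->
    i%:R * (f (s + m * g.+1 ^ i)%N - f s) <=
    i%:R * kappa * (m * g.+1 ^ i)%N%:R +
    A * (n%:R * K ^+ 2 * (m * g.+1 ^ i)%N%:R - energy s (m * g.+1 ^ i)).
Proof.
move=> A0 m0 step; elim=> [|i IH] s.
  move=> _; rewrite !mul0r add0r mulr_ge0 // subr_ge0; exact: energy_upper.
set l := (m * g.+1 ^ i)%N.
have -> : (m * g.+1 ^ i.+1 = g.+1 * l)%N by rewrite expnS mulnCA.
move=> sT; have lm : (m <= l)%N by rewrite leq_pmulr // expn_gt0.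
have {}step := step _ _ lm sT.
have tel : f (s + g.+1 * l)%N - f s =
    \sum_(r < g.+1) (f (s + r * l + l)%N - f (s + r * l)%N).
  rewrite -(big_mkord xpredT (fun r => f (s + r * l + l)%N - f (s + r * l)%N)).
  rewrite (eq_bigr (fun r => f (s + r.+1 * l)%N - f (s + r * l)%N)).
    by rewrite (telescope_sumr (fun r => f (s + r * l)%N)) // mul0n addn0.
  by move=> r _; rewrite mulSn -addnA (addnC l).
have IHs : i%:R * (f (s + g.+1 * l)%N - f s) <=
    i%:R * kappa * (g.+1 * l)%N%:R +
    A * (n%:R * K ^+ 2 * (g.+1 * l)%N%:R - \sum_(r < g.+1) energy (s + r * l) l).
  rewrite tel mulr_sumr.
  have cE (c : R) : c * (g.+1 * l)%N%:R = \sum_(r < g.+1) c * l%:R.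
    by rewrite sumr_const card_ord natrM mulrCA mulr_natl.
  rewrite !cE -sumrB mulr_sumr -big_split; apply: ler_sum => r _ /=.
  apply: IH; apply: leq_trans sT; rewrite -addnA leq_add2l -/l addnC -mulSn.
  by rewrite leq_mul2r ltn_ord orbT.
(* Adding [step] to [IHs] cancels the energies of the sub-blocks and leaves that of the whole
   block. *)
rewrite -natr1; lra.
Qed.

(** The errors per unit of time come, in order, from the departure from the initial queues, the
    splitting parameter [delta], the width of the last sub-block, the fixed cost at the smallest
    scale [m], and the energy budget spread over [k] scales. *)
Theorem trajectory_descent (g m k : nat) (delta eps : R) :
  T = (m * g.+1 ^ k)%N -> (0 < m)%N -> (0 < k)%N -> 0 < delta -> 0 < eps ->
  (forall j, 0 <= Q 0%N j) -> 0 < \sum_j Q 0%N j ->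
  eps * \sum_j Q 0%N j <= f 0%N ->
  f T - f 0%N <= T%:R * (- mu * (eps ^+ 2 -
      2 * eps * (block_cost * (T%:R + eta + 1)) / \sum_j Q 0%N j) +
    (n%:R + 1) * K * (n%:R * delta) + block_cost / g.+1%:R +
    block_cost * (eta + 1) / m%:R +
    (n%:R + 1) * K * (g.+1%:R / delta) * (n%:R * K ^+ 2) / k%:R).
Proof.
move=> TE m0 k0 delta0 eps0 Q0 X0 Xf.
set nu := eps ^+ 2 - _.
have gR : 0 < g.+1%:R :> R by rewrite ltr0n.
have mR : 0 < m%:R :> R by rewrite ltr0n.
have kR : 0 < k%:R :> R by rewrite ltr0n.
have bc0 := block_cost_ge0.
pose A := (n%:R + 1) * K * (g.+1%:R / delta).
have A0 : 0 <= A by rewrite !mulr_ge0 ?addr_ge0 ?invr_ge0 // ltW.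
pose kappa := - mu * nu + (n%:R + 1) * K * (n%:R * delta) +
  block_cost / g.+1%:R + block_cost * (eta + 1) / m%:R.
have step l s : (m <= l)%N -> (s + g.+1 * l <= T)%N ->
     f (s + g.+1 * l)%N - f s <= kappa * (g.+1 * l)%N%:R +
       A * (\sum_(r < g.+1) energy (s + r * l) l - energy s (g.+1 * l)).
  move=> ml sT; have l0 : (0 < l)%N by exact: leq_trans ml.
  have Gl0 : (0 < g.+1 * l)%N by rewrite muln_gt0.
  have lR : 0 < l%:R :> R by rewrite ltr0n.
  apply: le_trans (block_step l0 sT delta0) _.
  have := energy_lower Gl0 sT eps0 Q0 X0 Xf; rewrite -/nu => En.
  have {}En := ler_wpM2l mu_ge0 En.
  (* The block has length [g.+1 * l] with [l >= m]: the cost proportional to [l] weighs 1 / [g.+1]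
     per unit of time, the constant cost at most 1 / [m]. *)
  have cost : block_cost * (l%:R + eta + 1) <=
     (block_cost / g.+1%:R + block_cost * (eta + 1) / m%:R) * (g.+1 * l)%N%:R.
    rewrite natrM [leRHS]mulrDl [X in _ <= X + _]mulrA divfK ?gt_eqF //.
    rewrite -addrA mulrDr lerD2l.
    rewrite -(mulrA (block_cost * (eta + 1))).
    apply: ler_peMr; first by apply: mulr_ge0 => //; exact: addr_ge0.
    rewrite mulrC ler_pdivlMr // mul1r; apply: (@le_trans _ _ l%:R).
      by rewrite ler_nat.
    by rewrite ler_peMl // ler1n.
  rewrite /kappa /A; move: En cost.
  move: (energy s _) (\sum_(r < _) _) ((g.+1 * l)%N%:R) => E S L.
  move: (block_cost / g.+1%:R) (block_cost * (eta + 1) / m%:R) => c1 c2.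
  move: (block_cost * _) ((n%:R + 1) * K) (g.+1%:R / delta) => c3 c4 c5.
  generalize nu => nu' En cost.
  have -> : c4 * (n%:R * delta * L + c5 * (S - E)) =
    c4 * (n%:R * delta) * L + c4 * c5 * (S - E) by ring.
  rewrite !mulNr mulrDl; lra.
have := @multiscale_descent g m kappa A A0 m0 step k 0%N.
rewrite add0n -TE => /(_ (leqnn _)); set E := energy _ _ => main.
have E0 : 0 <= E.
  by apply: sumr_ge0 => j _; rewrite divr_ge0 ?sqr_ge0.
have {}main : k%:R * (f T - f 0%N) <=
    k%:R * kappa * T%:R + A * (n%:R * K ^+ 2 * T%:R).
  by apply: le_trans main _; rewrite lerD2l ler_wpM2l // lerBlDr lerDl.
rewrite -(ler_pM2l kR); apply: le_trans main _.
rewrite -/kappa -/A le_eqVlt; apply/orP; left; apply/eqP.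
have idE (k' a b T' : R) : k' != 0 ->
    k' * a * T' + A * (b * T') = k' * (T' * (a + A * b / k')).
  by move=> H; field.
by rewrite idE ?gt_eqF.
Qed.

End Trajectory.

(** * Discrete random variables *)

Section Discrete.
Context (d : measure_display) (Om : measurableType d) (R : realType)
  (P : probability Om R).

(** For countable [C] this is measurability for the discrete sigma-algebra, stated without putting a
    measurable structure on [C]. *)
Definition discrete_mfun (C : Type) (X : Om -> C) : Prop :=
  forall c, measurable [set w | X w = c].

Lemma discrete_preimage (C : countType) (X : Om -> C) (A : set C) :
  discrete_mfun X -> measurable (X @^-1` A).
Proof.
move=> mX.
have -> : X @^-1` A = \bigcup_(c in A) [set w | X w = c].
  apply/seteqP; split => [w Aw|w [c Ac /= XE]]; first by exists (X w).
    by rewrite /preimage /= XE.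
have -> : \bigcup_(c in A) [set w | X w = c] =
    \bigcup_c (if c \in A then [set w | X w = c] else set0).
  apply/seteqP; split => [w [c Ac ?]|w [c _]].
    by exists c => //; rewrite mem_set.
  by case: ifPn => // /set_mem Ac ?; exists c.
apply: countable_bigcupT_measurable => [|c]; first exact: countableP.
by case: ifPn.
Qed.

Lemma discrete_comp (C : countType) (C' : Type) (X : Om -> C) (f : C -> C') :
  discrete_mfun X -> discrete_mfun (f \o X).
Proof. by move=> mX c; exact: (discrete_preimage [set x | f x = c]). Qed.

Lemma discrete_measurable_fun (C : countType) (X : Om -> C) dT
    (T : measurableType dT) (f : C -> T) (D : set Om) :
  discrete_mfun X -> measurable_fun D (fun w => f (X w)).
Proof.
move=> mX mD B mB; apply: measurableI => //.
exact: (discrete_preimage (f @^-1` B)).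
Qed.

Lemma discrete_pair (C C' : countType) (X : Om -> C) (Y : Om -> C') :
  discrete_mfun X -> discrete_mfun Y -> discrete_mfun (fun w => (X w, Y w)).
Proof.
move=> mX mY [c c'].
have -> : [set w | (X w, Y w) = (c, c')] = [set w | X w = c] `&` [set w | Y w = c'].
  by apply/seteqP; split => [w [<- <-]|w [/= -> ->]].
exact: measurableI.
Qed.

(** Values are enumerated by their codes, so that sums over a countable type become series over
    [nat]; integers that code no value contribute empty sets. *)
Lemma integral_discrete_split (C : countType) (X : Om -> C) (D : set Om)
    (F : Om -> \bar R) : discrete_mfun X -> measurable D ->
  measurable_fun D F -> (forall w, D w -> 0 <= F w)%E ->
  (\int[P]_(w in D) F w = \sum_(0 <= k <oo)
     \int[P]_(w in D `&` [set w | choice.pickle (X w) = k]) F w)%E.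
Proof.
move=> mX mD mF F0.
have DE : D = \bigcup_k (D `&` [set w | choice.pickle (X w) = k]).
  by apply/seteqP; split => [w Dw|w [k _ []] //]; exists (choice.pickle (X w)).
have mk k : measurable (D `&` [set w | choice.pickle (X w) = k]).
  by apply: measurableI => //; exact: (discrete_comp choice.pickle mX).
rewrite {1}DE ge0_integral_bigcup -?DE //.
by move=> i j _ _ [w [[_ /= <-] [_ /= <-]]].
Qed.

Lemma measure_discrete_split (C : countType) (X : Om -> C) (D : set Om) :
  discrete_mfun X -> measurable D ->
  (P D = \sum_(0 <= k <oo) P (D `&` [set w | choice.pickle (X w) = k]))%E.
Proof.
move=> mX mD.
have mk k : measurable (D `&` [set w | choice.pickle (X w) = k]).
  by apply: measurableI => //; exact: (discrete_comp choice.pickle mX).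
rewrite -[LHS]mul1e -integral_cst // (integral_discrete_split mX) //.
by apply: eq_eseriesr => k _; rewrite integral_cst // mul1e.
Qed.

Lemma integral_discrete_point (C : countType) (X : Om -> C) (D : set Om)
    (f : C -> \bar R) (c : C) : discrete_mfun X -> measurable D ->
  (\int[P]_(w in D `&` [set w | choice.pickle (X w) = choice.pickle c]) f (X w) =
   f c * P (D `&` [set w | X w = c]))%E.
Proof.
move=> mX mD.
have -> : [set w | choice.pickle (X w) = choice.pickle c] = [set w | X w = c].
  apply/seteqP; split => w /= => [|-> //].
  exact: (pcan_inj (@choice.pickleK C)).
rewrite -integral_cst; last by apply: measurableI.
by apply: eq_integral => w /set_mem [_ ->].
Qed.

(** With [k] the probability of [D], the hypothesis says that [X] conditioned on [D] has the law of
    [Y]; the product form also makes sense when that probability is 0. *)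
Lemma integral_same_law (C : countType) (X Y : Om -> C) (D : set Om) (k : R)
    (f : C -> \bar R) : discrete_mfun X -> discrete_mfun Y -> measurable D ->
  (forall c, 0 <= f c)%E ->
  (forall c, P (D `&` [set w | X w = c]) = k%:E * P [set w | Y w = c])%E ->
  (\int[P]_(w in D) f (X w) = k%:E * \int[P]_w f (Y w))%E.
Proof.
move=> mX mY mD f0 law.
rewrite (integral_discrete_split mX) //; last exact: discrete_measurable_fun.
rewrite [in RHS](integral_discrete_split mY) //; last exact: discrete_measurable_fun.
rewrite -nneseriesZl; last by move=> i _; apply: integral_ge0.
apply: eq_eseriesr => i _.
have [[c <-]|nc] := pselect (exists c : C, choice.pickle c = i).
  by rewrite !integral_discrete_point // law setTI muleCA.
have E (D' : set Om) (Z : Om -> C) : D' `&` [set w | choice.pickle (Z w) = i] = set0.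
  by apply/seteqP; split => // w [_ /= Zi]; apply: nc; exists (Z w).
by rewrite !E !integral_set0 mule0.
Qed.

Lemma measure_same_law (C : countType) (X Y : Om -> C) (D : set Om) (k : R)
    (A : set C) : discrete_mfun X -> discrete_mfun Y -> measurable D ->
  (forall c, P (D `&` [set w | X w = c]) = k%:E * P [set w | Y w = c])%E ->
  (P (D `&` X @^-1` A) = k%:E * P (Y @^-1` A))%E.
Proof.
move=> mX mY mD law.
have mXA : measurable (X @^-1` A) by exact: discrete_preimage.
have mYA : measurable (Y @^-1` A) by exact: discrete_preimage.
have := @integral_same_law _ X Y D k (fun c => (\1_A c)%:E) mX mY mD _ law.
have E (Z : Om -> C) : (fun w => (\1_A (Z w))%:E : \bar R) =
    (fun w => (\1_(Z @^-1` A) w)%:E) by [].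
rewrite !E !integral_indic // setIT setIC; apply.
by move=> c; rewrite lee_fin.
Qed.

Lemma measure_independent (C C' : countType) (X : Om -> C) (Y : Om -> C')
    (A : set C) (B : set C') : discrete_mfun X -> discrete_mfun Y ->
  (forall c c', P ([set w | X w = c] `&` [set w | Y w = c']) =
     P [set w | X w = c] * P [set w | Y w = c'])%E ->
  (P (X @^-1` A `&` Y @^-1` B) = P (X @^-1` A) * P (Y @^-1` B))%E.
Proof.
move=> mX mY law.
have fin (D : set Om) : measurable D -> (fine (P D))%:E = P D.
  by move=> mD; rewrite fineK // fin_num_measure.
have mXA : measurable (X @^-1` A) by exact: discrete_preimage.
have mYB : measurable (Y @^-1` B) by exact: discrete_preimage.
rewrite setIC muleC -(fin _ mYB); apply: measure_same_law => // c.
rewrite fin // setIC muleC -(fin _ (mX c)); apply: measure_same_law => // c'.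
by rewrite fin.
Qed.

End Discrete.

(** * Positive recurrence of Markov families *)

Section MarkovFamily.
Context (d : measure_display) (Om : measurableType d) (R : realType)
  (P : probability Om R) (E : countType).
Variable Z : E -> nat -> Om -> E.

(* The states at times [t], ..., 1, in this order. *)
Fixpoint history (x : E) (t : nat) (w : Om) : seq E :=
  if t is t'.+1 then Z x t w :: history x t' w else [::].

(** [markov_step] joins the Markov property and time homogeneity: given the history, the next state
    is distributed as the first step from the current state [head x l], whose default [x] serves
    time 0. *)
Record markov_family : Prop := {
  markov_measurable : forall x t, discrete_mfun (Z x t);
  markov_start : forall x w, Z x 0%N w = x;
  markov_step : forall x t l y,
    P ([set w | history x t w = l] `&` [set w | Z x t.+1 w = y]) =
    (P [set w | history x t w = l] * P [set w | Z (head x l) 1%N w = y])%E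
}.

Hypothesis HZ : markov_family.
Local Open Scope ereal_scope.

Let mZ := markov_measurable HZ.

Lemma history_measurable x t : discrete_mfun (history x t).
Proof.
elim: t => [|t IH] /= => [l|].
  have [<-|nl] := pselect ([::] = l).
    by rewrite (_ : [set _ | _] = setT) //; apply/seteqP.
  by rewrite (_ : [set _ | _] = set0) //; apply/seteqP; split => // w /nl.
exact: (discrete_comp (fun yl => yl.1 :: yl.2) (discrete_pair (mZ x t.+1) IH)).
Qed.

Lemma head_history x t w : head x (history x t w) = Z x t w.
Proof. by case: t => //=; rewrite (markov_start HZ). Qed.

Definition step (f : E -> \bar R) (x : E) : \bar R := \int[P]_w f (Z x 1%N w).

Lemma markov_integral x t (A : set (seq E)) (f : E -> \bar R) :
  (forall y, 0 <= f y) ->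
  \int[P]_(w in history x t @^-1` A) f (Z x t.+1 w) =
  \int[P]_(w in history x t @^-1` A) step f (Z x t w).
Proof.
move=> f0.
have mH := @history_measurable x t.
have mA : measurable (history x t @^-1` A) by exact: discrete_preimage.
have s0 y : 0 <= step f y by apply: integral_ge0.
rewrite (integral_discrete_split P mH) //; last exact: discrete_measurable_fun.
rewrite [RHS](integral_discrete_split P mH) //; last exact: discrete_measurable_fun.
apply: eq_eseriesr => k _.
have [[l lk]|nk] := pselect (exists2 l, A l & choice.pickle l = k); last first.
  rewrite (_ : _ `&` _ = set0) ?integral_set0 //.
  by apply/seteqP; split => // w [/= Aw wk]; apply: nk; exists (history x t w).
move=> <-; have -> : history x t @^-1` A `&`
    [set w | choice.pickle (history x t w) = choice.pickle l] =
    [set w | history x t w = l].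
  apply/seteqP; split => w /= => [[_]|wl]; last by rewrite /preimage /= wl.
  exact: (pcan_inj (@choice.pickleK _)).
have Pl : P [set w | history x t w = l] \is a fin_num by exact: fin_num_measure.
rewrite (@integral_same_law _ _ _ P _ (Z x t.+1) (Z (head x l) 1%N) _
  (fine (P [set w | history x t w = l]))) //; last first.
  by move=> y; rewrite fineK // markov_step.
rewrite fineK // muleC -integral_cst //.
by apply: eq_integral => w /set_mem /= wl; rewrite -(head_history x t) wl.
Qed.

Definition kill (B : set E) (f : E -> \bar R) (y : E) : \bar R :=
  if `[< B y >] then 0 else f y.

(** The transition operator of the chain killed on entering [B]; the starting point itself may lie
    in [B]. *)
Definition killed_step (B : set E) (f : E -> \bar R) : E -> \bar R :=
  step (kill B f).

Lemma kill_ge0 B f y : (forall y, 0 <= f y) -> 0 <= kill B f y.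
Proof. by move=> f0; rewrite /kill; case: ifP. Qed.

Lemma killed_step_ge0 B f y : (forall y, 0 <= f y) -> 0 <= killed_step B f y.
Proof. by move=> f0; apply: integral_ge0 => w _; exact: kill_ge0. Qed.

Lemma iter_killed_step_ge0 B f t y : (forall y, 0 <= f y) ->
  0 <= iter t (killed_step B) f y.
Proof.
by move=> f0; elim: t y => [|t IH] y //=; exact: killed_step_ge0.
Qed.

Definition avoids (B : set E) : set (seq E) :=
  [set l : seq E | forall y, y \in l -> ~ B y].

(** The last transition is integrated out by the Markov property, which reduces [t.+1] to [t]. Time
    0 is not in the history, so the start is not tested against [B]. *)
Lemma killed_step_integral B x t f : (forall y, 0 <= f y) ->
  \int[P]_(w in history x t @^-1` avoids B) f (Z x t w) =
  iter t (killed_step B) f x.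
Proof.
elim: t f => [|t IH] f f0 /=.
  rewrite (_ : _ @^-1` _ = setT); last by apply/seteqP; split.
  under eq_integral do rewrite (markov_start HZ).
  rewrite integral_cst // -[RHS]mule1; congr (_ * _); exact: probability_setT.
rewrite -iterS iterSr -IH; last by move=> y; exact: killed_step_ge0.
rewrite -markov_integral; last by move=> y; exact: kill_ge0.
rewrite [LHS]integral_mkcond [RHS]integral_mkcond; apply: eq_integral => w _.
rewrite !patchE /kill.
have [Bw|nB] := pselect (B (Z x t.+1 w)).
  rewrite (asboolT Bw) memNset => [|/(_ (Z x t.+1 w))]; first by case: ifP.
  by apply => //; rewrite inE eqxx.
rewrite (asboolF nB); congr (if _ then _ else _); apply: asbool_equiv_eq.
split => H y yl; first by apply: H; rewrite inE yl orbT.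
by move: yl; rewrite inE => /predU1P [->|/H].
Qed.

(** The tail formula for the mean return time: the sum over t of the probability that [B] is avoided
    at times 1, ..., t. *)
Definition mean_hitting (B : set E) (x : E) : \bar R :=
  \sum_(0 <= t <oo) iter t (killed_step B) (cst 1) x.

Lemma avoidsP B x t w : avoids B (history x t w) <->
  forall s, (0 < s <= t)%N -> ~ B (Z x s w).
Proof.
elim: t => [|t IH] /=; first by split=> // _ [|s] //.
split => [H s /andP[s0]|H y].
  rewrite leq_eqVlt => /predU1P [->|st]; first by apply: H; rewrite inE eqxx.
  apply: (IH.1 _ s); last by rewrite s0.
  by move=> y yl; apply: H; rewrite inE yl orbT.
rewrite inE => /predU1P [->|]; first by apply: H; rewrite /= leqnn.
by apply: IH.2 => s /andP[s0 st]; apply: H; rewrite s0 ltnW.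
Qed.

(** Tail formula path by path: the return time counts the t such that [B] is avoided up to t. Both
    sides are infinite when [B] is never visited. *)
Lemma return_time_series x B w : return_time R Z x B w =
  \sum_(0 <= t <oo) (\1_(history x t @^-1` avoids B) w)%:E.
Proof.
have I0 t : 0 <= (\1_(history x t @^-1` avoids B) w)%:E :> \bar R by rewrite lee_fin.
have [[t Bt]|nB] := pselect (exists t, (0 < t)%N && `[< B (Z x t w) >]); last first.
  have -> : return_time R Z x B w = +oo.
    rewrite /return_time (_ : [set _ | _ in _] = set0) ?ereal_inf0 //.
    apply/seteqP; split => // _ [t /= [t0 Bt] _]; apply: nB; exists t.
    by rewrite t0; apply/asboolP.
  apply/esym/eq_infty => r; have [k rk] : exists k : nat, (r <= k%:R)%R.
    by exists (Num.truncn r).+1; exact/ltW/truncnS_gt.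
  apply: (@le_trans _ _ k%:R%:E); first by rewrite lee_fin.
  apply: le_trans (@nneseries_lim_ge _ _ xpredT 0%N k (fun i _ _ => I0 i)).
  rewrite (eq_bigr (fun=> 1)) => [|t _].
    by rewrite sumEFin sumr_const_nat subn0.
  rewrite indicE mem_set //; apply/avoidsP => s /andP[s0 _] Bs.
  by apply: nB; exists s; rewrite s0; apply/asboolP.
have ex : exists t, (0 < t)%N && `[< B (Z x t w) >] by exists t.
case: (ex_minnP ex) => m /andP[m0 /asboolP Bm] mmin.
have -> : return_time R Z x B w = m%:R%:E.
  apply/eqP; rewrite eq_le; apply/andP; split.
    by apply: ereal_inf_lbound; exists m.
  apply: le_ereal_inf_tmp => _ [s /= [s0 Bs] <-]; rewrite lee_fin ler_nat.
  by apply: mmin; rewrite s0; apply/asboolP.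
rewrite (@nneseries_split _ _ 0%N m) // add0n eseries0 ?adde0; last first => [t' mt _|].
  by rewrite indicE memNset // => /avoidsP /(_ m); apply; rewrite // m0.
rewrite (eq_big_nat _ _ (F2 := fun=> 1)) => [|s /= sm].
  by rewrite sumEFin sumr_const_nat subn0.
rewrite indicE mem_set //; apply/avoidsP => s' /andP[s0 ss'] Bs.
have := mmin s'; rewrite s0 /= => /(_ (asboolT Bs)); rewrite leqNgt.
by rewrite (leq_ltn_trans ss' sm).
Qed.

Lemma mean_return_timeE x B : mean_return_time P Z x B = mean_hitting B x.
Proof.
have mA t : measurable (history x t @^-1` avoids B).
  by apply: discrete_preimage; exact: history_measurable.
rewrite /mean_return_time; under eq_integral do rewrite return_time_series.
rewrite integral_nneseries //; last first.
  by move=> n; apply/measurable_EFinP; exact: measurable_indic.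
apply: eq_eseriesr => t _; rewrite -killed_step_integral //.
by rewrite integral_indic // setIT integral_cst // mul1e.
Qed.

Lemma le_step f g x : (forall y, 0 <= f y) -> (forall y, f y <= g y) ->
  step f x <= step g x.
Proof.
move=> f0 fg; apply: ge0_le_integral => [//|w _ //|||w _ //].
  exact: discrete_measurable_fun.
exact: discrete_measurable_fun.
Qed.

Lemma le_killed_step B f g x : (forall y, 0 <= f y) ->
  (forall y, ~ B y -> f y <= g y) -> killed_step B f x <= killed_step B g x.
Proof.
move=> f0 fg; apply: le_step => y; first exact: kill_ge0.
by rewrite /kill; case: asboolP => // nB; exact: fg.
Qed.

Lemma killed_stepD B f g x : (forall y, 0 <= f y) -> (forall y, 0 <= g y) ->
  killed_step B (f \+ g) x = killed_step B f x + killed_step B g x.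
Proof.
move=> f0 g0; rewrite /killed_step /step -ge0_integralD //; last first.
- exact: discrete_measurable_fun.
- by move=> w _; exact: kill_ge0.
- exact: discrete_measurable_fun.
- by move=> w _; exact: kill_ge0.
apply: eq_integral => w _; rewrite /kill; case: asboolP => _ //.
by rewrite adde0.
Qed.

Lemma killed_stepZ B k f x : 0 <= k -> (forall y, 0 <= f y) ->
  killed_step B (fun y => k * f y) x = k * killed_step B f x.
Proof.
move=> k0 f0; rewrite /killed_step /step -ge0_integralZl //; last first.
- by move=> w _; exact: kill_ge0.
- exact: discrete_measurable_fun.
apply: eq_integral => w _; rewrite /kill; case: asboolP => _ //.
by rewrite mule0.
Qed.

Lemma killed_step_series B (f : nat -> E -> \bar R) x :
  (forall t y, 0 <= f t y) ->
  killed_step B (fun y => \sum_(0 <= t <oo) f t y) x =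
  \sum_(0 <= t <oo) killed_step B (f t) x.
Proof.
move=> f0; rewrite /killed_step /step -integral_nneseries //; last first.
- by move=> t w _; exact: kill_ge0.
- by move=> t; exact: (discrete_measurable_fun (kill B (f t))).
apply: eq_integral => w _; rewrite /kill; case: asboolP => _ //.
by rewrite eseries0.
Qed.

Lemma killed_series_rec B f x : (forall y, 0 <= f y) ->
  \sum_(0 <= t <oo) iter t (killed_step B) f x =
  f x + killed_step B (fun y => \sum_(0 <= t <oo) iter t (killed_step B) f y) x.
Proof.
move=> f0; have F0 t y : 0 <= iter t (killed_step B) f y by exact: iter_killed_step_ge0.
rewrite killed_step_series // nneseries_recl //; congr (_ + _).
by rewrite -nneseries_addn // ; apply: eq_eseriesr => t _; rewrite addn1.
Qed.

(** Minimality of the series among nonnegative supersolutions, by induction on partial sums.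
    Finiteness after a change of [B] is later proved by exhibiting such a [g]. *)
Lemma killed_series_le B f g x : (forall y, 0 <= f y) -> (forall y, 0 <= g y) ->
  (forall y, f y + killed_step B g y <= g y) ->
  \sum_(0 <= t <oo) iter t (killed_step B) f x <= g x.
Proof.
move=> f0 g0 fg.
have F0 t y : 0 <= iter t (killed_step B) f y by exact: iter_killed_step_ge0.
apply: lime_le; first by apply: is_cvg_nneseries.
apply: nearW => N; elim: N x => [|N IH] x /=.
  by rewrite big_geq.
apply: le_trans (fg x); rewrite big_nat_recl //= leeD2l //.
have -> : \sum_(0 <= t < N) killed_step B (iter t (killed_step B) f) x =
   killed_step B (fun y => \sum_(0 <= t < N) iter t (killed_step B) f y) x.
  elim: N {IH} => [|N IHN].
    rewrite big_geq // /killed_step /step integral0_eq // => w _.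
    by rewrite /kill big_geq //; case: ifP.
  rewrite big_nat_recr //= IHN -killed_stepD //; last first.
    by move=> y; exact: sume_ge0.
  congr (killed_step B _ x); apply/funext => y.
  by rewrite [RHS]big_nat_recr.
apply: le_killed_step => // y; exact: sume_ge0.
Qed.

End MarkovFamily.

(** * Foster's criterion and reduction to positive recurrent states *)

Section Recurrence.
Context (d : measure_display) (Om : measurableType d) (R : realType)
  (P : probability Om R) (E : countType).
Variable Z : E -> nat -> Om -> E.
Hypothesis HZ : markov_family P Z.
Local Open Scope ereal_scope.
Let mZ := markov_measurable HZ.
Let L := killed_step P Z.
Let H := mean_hitting P Z.

Lemma measurable_avoids x B t : measurable (history Z x t @^-1` avoids B).
Proof. by apply: discrete_preimage; exact: (history_measurable HZ). Qed.

Lemma iter_killed_step_le1 B t x : iter t (L B) (cst 1) x <= 1.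
Proof.
rewrite /L -(killed_step_integral HZ) //.
rewrite integral_cst //; last exact: measurable_avoids.
by rewrite mul1e; apply: probability_le1; exact: measurable_avoids.
Qed.

Lemma iter_killed_step_le B t f x : (0 < t)%N -> (forall y, 0 <= f y) ->
  iter t (L B) f x <= \int[P]_w kill B f (Z x t w).
Proof.
move=> t0 f0; rewrite /L -(killed_step_integral HZ) //.
rewrite (eq_integral (fun w => kill B f (Z x t w))).
  apply: ge0_subset_integral => //; first exact: measurable_avoids.
    exact: (discrete_measurable_fun (kill B f)).
  by move=> w _; exact: kill_ge0.
move=> w /set_mem /avoidsP A; rewrite /kill asboolF //.
by apply: A; rewrite t0 leqnn.
Qed.

(** The series is cut into windows of length [T]. The first contributes at most [T]; the rest is the
    same sum started from [Z x T], to which the induction applies. *)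
Lemma mean_hitting_foster (B : set E) (T : nat) (g : E -> \bar R) x :
  (0 < T)%N -> (forall y, 0 <= g y) ->
  (forall y, 1 + \int[P]_w kill B g (Z y T w) <= g y) ->
  H B x <= T%:R%:E * g x.
Proof.
move=> T0 g0 Hg.
have I0 t y : 0 <= iter t (L B) (cst 1) y by exact: iter_killed_step_ge0.
have T0R : 0 <= T%:R%:E :> \bar R by rewrite lee_fin.
have S N : \sum_(0 <= t < N * T) iter t (L B) (cst 1) x <= T%:R%:E * g x.
  elim: N x => [|N IH] x; first by rewrite mul0n big_geq // mule_ge0.
  rewrite mulSn (big_cat_nat _ (n := T)) ?leq_addr //=.
  apply: le_trans (lee_wpmul2l T0R (Hg x)); rewrite ge0_muleDr //; last first.
    by apply: integral_ge0 => w _; exact: kill_ge0.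
  apply: leeD.
    rewrite mule1 -[T in T%:R]subn0 -sumr_const_nat -sumEFin.
    by apply: lee_sum => t _; exact: iter_killed_step_le1.
  rewrite -{1}[T]add0n big_addn addKn.
  under eq_bigr => t _ do rewrite addnC iterD -(killed_step_integral HZ) //.
  rewrite -ge0_integral_sum //; last 2 first.
    exact: measurable_avoids.
    by move=> t; exact: (discrete_measurable_fun (iter t (L B) (cst 1))).
  apply: (@le_trans _ _ (\int[P]_(w in history Z x T @^-1` avoids B)
      (T%:R%:E * g (Z x T w)))).
    apply: ge0_le_integral.
    - exact: measurable_avoids.
    - by move=> w _; exact: sume_ge0.
    - exact: (discrete_measurable_fun
        (fun y => \sum_(0 <= t < N * T) iter t (L B) (cst 1) y)).
    - exact: (discrete_measurable_fun (fun y => T%:R%:E * g y)).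
    - by move=> w _; exact: IH.
  rewrite ge0_integralZl //; last 2 first.
    exact: measurable_avoids.
    exact: discrete_measurable_fun.
  apply: lee_wpmul2l => //; rewrite (killed_step_integral HZ) //.
  exact: iter_killed_step_le.
apply: lime_le; first by apply: is_cvg_nneseries.
apply: nearW => N; apply: le_trans (S N).
rewrite [leRHS](big_cat_nat _ (n := N)) ?leq_pmulr //=.
by rewrite leeDl // sume_ge0.
Qed.

Let on (B : set E) (y : E) : \bar R := if `[< B y >] then 1 else 0.

Let on_ge0 B y : 0 <= on B y.
Proof. by rewrite /on; case: ifP. Qed.

Let step_cst1 x : step P Z (cst 1) x = 1.
Proof.
rewrite /step integral_cst // mul1e; exact: probability_setT.
Qed.

Lemma step_split (B : set E) f x : (forall y, 0 <= f y) ->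
  step P Z f x = L B f x + step P Z (fun y => on B y * f y) x.
Proof.
move=> f0; rewrite /L /killed_step /step -ge0_integralD //; last first.
- exact: (discrete_measurable_fun (fun y => on B y * f y)).
- by move=> w _; rewrite mule_ge0.
- exact: (discrete_measurable_fun (kill B f)).
- by move=> w _; exact: kill_ge0.
apply: eq_integral => w _; rewrite /kill /on; case: asboolP => _.
  by rewrite mul1e add0e.
by rewrite mul0e adde0.
Qed.

Section RemovePoint.
Variables (B : set E) (b : E).
Hypothesis Bb : B b.
Hypothesis HB : forall x, H B x < +oo.

Let H0 x : 0 <= H B x.
Proof. by apply: nneseries_ge0 => t _ _; exact: iter_killed_step_ge0. Qed.

Let H_rec x : H B x = 1 + L B (H B) x.
Proof. by rewrite {1}/H /mean_hitting (killed_series_rec HZ). Qed.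

(* [h x] is the probability that the first return to B from x is at b. *)
Let h x := \sum_(0 <= t <oo) iter t (L B) (step P Z (on [set b])) x.

Let s0 A y : 0 <= step P Z (on A) y.
Proof. by apply: integral_ge0. Qed.

Let h0 x : 0 <= h x.
Proof. by apply: nneseries_ge0 => t _ _; exact: iter_killed_step_ge0. Qed.

Let h_rec x : h x = step P Z (on [set b]) x + L B h x.
Proof. by rewrite {1}/h (killed_series_rec HZ). Qed.

Let B' := B `\ b.

Let one_split x : 1 = L B (cst 1) x + (step P Z (on [set b]) x + step P Z (on B') x).
Proof.
rewrite -[LHS](step_cst1 x) (step_split B) //; congr (_ + _).
rewrite /step -ge0_integralD //; last first.
- exact: discrete_measurable_fun.
- exact: discrete_measurable_fun.
apply: eq_integral => w _; rewrite mule1 /on /B'.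
case: (asboolP (B _)) => By; case: (asboolP ([set b] _)) => [yb|nyb].
- by rewrite asboolF ?adde0 // => -[_]; apply.
- by rewrite asboolT ?add0e.
- by case: By; rewrite yb.
- by rewrite asboolF ?adde0 // => -[].
Qed.

Let h1 x : h x <= 1.
Proof.
apply: (@killed_series_le _ _ _ _ _ _ HZ B (step P Z (on [set b])) (cst 1)) => //= y.
rewrite [leRHS](one_split y) addeC leeD2l //.
by rewrite leeDl.
Qed.

Let hfin x : h x \is a fin_num.
Proof. by rewrite ge0_fin_numE //; apply: le_lt_trans (h1 x) _; rewrite ltry. Qed.

Let k x := 1 - h x.

Let k0 x : 0 <= k x.
Proof. by rewrite /k sube_ge0 ?hfin ?orbT. Qed.

Let hk x : h x + k x = 1.
Proof. by rewrite /k addeC subeK. Qed.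

Let k_rec x : k x = step P Z (on B') x + L B k x.
Proof.
have : h x + k x = h x + (step P Z (on B') x + L B k x).
  rewrite hk [LHS](one_split x).
  have -> : cst 1 = h \+ k by apply/funext => y; rewrite /= hk.
  rewrite /L (killed_stepD HZ) // [in RHS]h_rec /L.
  rewrite addeACA [step P Z (on [set b]) x + _]addeC.
  rewrite [step P Z (on B') x + _]addeC.
  by [].
by move/(congr1 (fun u => u - h x)); rewrite ![h x + _]addeC !addeK.
Qed.

(** The mean time to return to [B'] is that of one excursion to [B] plus, when it ends at [b], a
    restart from [b] of mean [c]. As [h b < 1], [c] is finite, and this sum [g] is a supersolution
    for [B']. *)
Lemma remove_point : h b < 1 -> forall x, H B' x < +oo.
Proof.
move=> hb x.
have Hfin : H B b \is a fin_num by rewrite ge0_fin_numE.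
(* [c] solves [c = H B b + h b * c], so that [g b = c]. *)
pose c : R := (fine (H B b) / (1 - fine (h b)))%R.
have hb1 : (0 < 1 - fine (h b))%R.
  by rewrite subr_gt0 -lte_fin fineK.
have c0 : 0 <= c%:E by rewrite lee_fin divr_ge0 ?fine_ge0 // ltW.
pose g y := H B y + c%:E * h y.
have gb : g b = c%:E.
  rewrite /g -(fineK Hfin) -(fineK (hfin b)) -EFinM -EFinD; congr EFin.
  have -> : fine (H B b) = (c * (1 - fine (h b)))%R.
    by rewrite /c divfK // gt_eqF.
  ring.
have g0 y : 0 <= g y by rewrite adde_ge0 // mule_ge0.
have gfin : g x < +oo.
  by rewrite lte_add_pinfty //; rewrite -(fineK (hfin x)) -EFinM ltry.
apply: le_lt_trans gfin.
apply: (@killed_series_le _ _ _ _ _ _ HZ B' (cst 1) g) => //= y.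
have -> : killed_step P Z B' g y = L B g y + c%:E * step P Z (on [set b]) y.
  rewrite /killed_step /L /killed_step /step -ge0_integralZl //; last first.
    exact: discrete_measurable_fun.
  rewrite -ge0_integralD //; last first.
  - exact: (discrete_measurable_fun (fun y => c%:E * on [set b] y)).
  - by move=> w _; rewrite mule_ge0.
  - exact: (discrete_measurable_fun (kill B g)).
  - by move=> w _; exact: kill_ge0.
  apply: eq_integral => w _; rewrite /kill /on /B'.
  case: (asboolP ([set b] _)) => [->|nyb].
    rewrite (asboolT Bb) asboolF; last by move=> -[_]; apply.
    by rewrite gb mule1 add0e.
  rewrite mule0 adde0; congr (if _ then _ else _).
  by apply: asbool_equiv_eq; split => [[]|].
have -> : L B g y = L B (H B) y + c%:E * L B h y.
  rewrite /g /L -(killed_stepZ HZ) // -(killed_stepD HZ) //.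
  by move=> z; rewrite mule_ge0.
rewrite addeA addeA -H_rec -addeA -ge0_muleDr //; last exact: killed_step_ge0.
by rewrite addeC [X in c%:E * X]addeC -h_rec /g addeC.
Qed.

(** If the first return to [B] from [b] is almost surely at [b], returning to [b] takes the same
    time as returning to [B]. *)
Lemma certain_return : h b = 1 -> H [set b] b < +oo.
Proof.
(* [g] is infinite where the first return to B may fail to be at b. *)
move=> hb; pose g y := H B y + +oo * k y.
have g0 y : 0 <= g y by rewrite adde_ge0 // mule_ge0.
(* As [k b = 0], the convention that [+oo] times 0 is 0 keeps [g b] finite. *)
have gb : g b = H B b by rewrite /g /k hb subee // mule0 adde0.
apply: (@le_lt_trans _ _ (g b)); last by rewrite gb.
apply: (@killed_series_le _ _ _ _ _ _ HZ [set b] (cst 1) g) => //= y.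
apply: (@le_trans _ _ (1 + (L B g y + +oo * step P Z (on B') y))).
  apply: leeD2l; rewrite /L /killed_step /step -ge0_integralZl //; last first.
    exact: discrete_measurable_fun.
  rewrite -ge0_integralD //; last first.
  - exact: (discrete_measurable_fun (fun y => +oo * on B' y)).
  - by move=> w _; rewrite mule_ge0.
  - exact: (discrete_measurable_fun (kill B g)).
  - by move=> w _; exact: kill_ge0.
  apply: ge0_le_integral => //.
  - by move=> w _; exact: kill_ge0.
  - exact: (discrete_measurable_fun (kill [set b] g)).
  - exact: (discrete_measurable_fun (fun y => kill B g y + +oo * on B' y)).
  move=> w _; rewrite /kill /on /B'.
  case: (asboolP ([set b] _)) => [yb|nyb].
    by rewrite adde_ge0 ?mule_ge0 //; case: ifP.
  case: (asboolP (B _)) => By.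
    by rewrite asboolT // add0e mule1 leey.
  by rewrite asboolF ?mule0 ?adde0 // => -[].
have -> : L B g y = L B (H B) y + +oo * L B k y.
  rewrite /g /L -(killed_stepZ HZ) // -(killed_stepD HZ) //.
  by move=> z; rewrite mule_ge0.
rewrite addeA addeA -H_rec -addeA -ge0_muleDr //; last exact: killed_step_ge0.
by rewrite [X in +oo * X]addeC -k_rec.
Qed.

Lemma positive_recurrent_or_removable :
  positive_recurrent_state P Z b \/ forall x, H B' x < +oo.
Proof.
have := h1 b; rewrite le_eqVlt => /predU1P[hb|hb].
  by left; rewrite /positive_recurrent_state (mean_return_timeE HZ) certain_return.
by right; exact: remove_point.
Qed.

End RemovePoint.

(** Points that are not positive recurrent are removed one at a time, the mean return times to the
    remaining set staying finite; this ends because the set is finite. *)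
Lemma positive_recurrent_of_finite_hitting (B : set E) : finite_set B ->
  (forall x, H B x < +oo) -> positive_recurrent P Z.
Proof.
move=> /finite_fsetP [F ->] {B}.
move: {2}(#|` F|) (leqnn #|` F|) => n; elim: n F => [|n IH] F.
  rewrite leqn0 cardfs_eq0 => /eqP -> HF; exists [set` fset0]; split => //.
  by move=> x; rewrite (mean_return_timeE HZ).
move=> Fn HF.
have [[b bF nb]|all] := pselect (exists2 b, b \in F & ~ positive_recurrent_state P Z b).
  have [//|HB'] := @positive_recurrent_or_removable [set` F] b bF HF.
  apply: (IH (F `\ b)%fset).
    by rewrite -ltnS; apply: leq_trans Fn; rewrite (cardfsD1 b F) bF.
  suff -> : [set` (F `\ b)%fset] = [set` F] `\ b by [].
  apply/seteqP; split => y /=; rewrite !inE.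
    by case/andP => /eqP ? ?.
  by case=> ? ?; apply/andP; split => //; apply/eqP.
exists [set` F]; split => [//|x xF|x].
  by apply: contrapT => nx; apply: all; exists x.
by rewrite (mean_return_timeE HZ).
Qed.

Theorem foster_criterion (V : E -> R) (T : nat) (B : set E) :
  (0 < T)%N -> finite_set B -> (forall x, 0 <= V x)%R ->
  (forall x, \int[P]_w (V (Z x T w))%:E < +oo) ->
  (forall x, ~ B x -> \int[P]_w (V (Z x T w))%:E + 1 <= (V x)%:E) ->
  positive_recurrent P Z.
Proof.
move=> T0 finB V0 Vfin Vdrift.
apply: (positive_recurrent_of_finite_hitting finB) => x.
(* On [B], where [V] need not decrease, [g] takes the value that makes the Foster inequality hold;
   it is finite because the mean of [V] after [T] steps is. *)
pose g y := if `[< B y >] then 1 + \int[P]_w (V (Z y T w))%:E else (V y)%:E.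
have I0 y : 0 <= \int[P]_w (V (Z y T w))%:E.
  by apply: integral_ge0 => w _; rewrite lee_fin.
have g0 y : 0 <= g y.
  by rewrite /g; case: ifP => _; rewrite ?lee_fin // adde_ge0.
apply: (@le_lt_trans _ _ (T%:R%:E * g x)); last first.
  rewrite lte_mul_pinfty // ?lee_fin // /g; case: ifP => _; last exact: ltry.
  by rewrite lte_add_pinfty // ltry.
apply: mean_hitting_foster => // y.
apply: (@le_trans _ _ (1 + \int[P]_w (V (Z y T w))%:E)).
  apply: leeD2l; apply: ge0_le_integral => //.
  - by move=> w _; exact: kill_ge0.
  - exact: (discrete_measurable_fun (kill B g)).
  - exact: (discrete_measurable_fun (fun y => (V y)%:E)).
  move=> w _; rewrite /kill /g; case: asboolP => // _.
  by rewrite lee_fin.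
rewrite /g; case: asboolP => // nB; rewrite addeC; exact: Vdrift.
Qed.

End Recurrence.

(** * Independence and the Markov property of the network *)

Section Independence.
Context (d : measure_display) (Om : measurableType d) (R : realType)
  (P : probability Om R) (I : choiceType).

Lemma mutually_independent_reindex (I' : choiceType) (F : I -> set (set Om))
    (iota : I' -> I) : injective iota -> mutually_independent P F ->
  mutually_independent P (F \o iota).
Proof.
move=> inj indF J A FA.
have [J0|[i0 i0J]] := fset_0Vmem J.
  rewrite J0 big_seq_fset0 (_ : [set` fset0] = set0) ?bigcap_set0.
    exact: probability_setT.
  by apply/seteqP; split => // i /=; rewrite in_fset0.
(* Transports [A] along [iota]; only the values on the image of [J] are used below. *)
pose inv (i : I) := if pselect (exists2 j, j \in J & iota j = i) is left e
  then A (xget i0 [set j | j \in J /\ iota j = i]) else set0.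
have invE j : j \in J -> inv (iota j) = A j.
  move=> jJ; rewrite /inv; case: pselect => [e|]; last by case; exists j.
  case: xgetP => [k _ [_ /inj ->]//|/(_ j) []].
  by split.
have := indF (iota @` J)%fset inv.
rewrite big_imfset /=; last by move=> x y _ _ /inj.
rewrite (eq_big_seq (fun j => P (A j))) => [<-|j jJ]; last by rewrite invE.
  congr (P _); apply/seteqP; split => w H j /=.
    by case/imfsetP => k kJ ->; rewrite invE //; exact: H.
  by move=> jJ; rewrite -invE //; apply: H => /=; rewrite in_imfset.
by move=> i /imfsetP[j jJ ->]; rewrite invE //; exact: FA.
Qed.

Section Values.
Variables (F : I -> set (set Om)) (V : I -> Om -> nat).
Hypothesis indF : mutually_independent P F.
Hypothesis FV : forall i a, F i [set w | V i w = a].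
Hypothesis mV : forall i, discrete_mfun (V i).

Definition values (J : {fset I}) (w : Om) : seq nat := [seq V i w | i <- J].

Definition lookup (J : {fset I}) (s : seq nat) (i : I) : nat :=
  nth 0%N s (index i J).

Lemma lookup_values J w i : i \in J -> lookup J (values J w) i = V i w.
Proof.
by move=> iJ; rewrite /lookup /values (nth_map i) ?index_mem // nth_index.
Qed.

Lemma values_eqP J w s : size s = #|` J| ->
  values J w = s <-> forall i, i \in J -> V i w = lookup J s i.
Proof.
move=> sz; split => [<- i iJ|H]; first by rewrite lookup_values.
apply: (@eq_from_nth _ 0%N); first by rewrite size_map.
move=> k; rewrite size_map => kJ.
have [i iJ <-] : exists2 i, i \in J & index i J = k.
  have ex (s' : seq I) : uniq s' -> (k < size s')%N ->
      exists2 i, i \in s' & index i s' = k.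
    case: s' => // i0 s' us' ks'; exists (nth i0 (i0 :: s') k).
      exact: mem_nth.
    exact: index_uniq.
  exact: ex (fset_uniq J) kJ.
by rewrite -[LHS]/(lookup J (values J w) i) lookup_values // H.
Qed.

Lemma values_size J w : size (values J w) = #|` J|.
Proof. by rewrite size_map. Qed.

Lemma values_setE J s : size s = #|` J| ->
  [set w | values J w = s] =
  \bigcap_(i in [set` J]) [set w | V i w = lookup J s i].
Proof.
move=> sz; apply/seteqP; split => w; first by move/(values_eqP _ sz).
by move=> H; apply/(values_eqP _ sz).
Qed.

Lemma values_set0 J s : size s <> #|` J| -> [set w | values J w = s] = set0.
Proof.
move=> sz; apply/seteqP; split => // w /= ws; case: sz.
by rewrite -ws values_size.
Qed.

Lemma values_measurable J : discrete_mfun (values J).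
Proof.
move=> s; have [sz|sz] := pselect (size s = #|` J|); last by rewrite values_set0.
rewrite values_setE //; apply: fin_bigcap_measurable => //.
by move=> i _; exact: mV.
Qed.

Lemma values_law J s : size s = #|` J| ->
  (P [set w | values J w = s] = \prod_(i <- J) P [set w | V i w = lookup J s i])%E.
Proof. by move=> sz; rewrite values_setE // indF. Qed.

Definition depends_on (J : {fset I}) (A : set Om) : Prop :=
  forall w w', (forall i, i \in J -> V i w = V i w') -> A w -> A w'.

Lemma depends_on_preimage J A : depends_on J A ->
  A = values J @^-1` (values J @` A).
Proof.
move=> JA; apply/seteqP; split => w; first by exists w.
move=> [w' Aw' vE]; apply: JA Aw' => i iJ.
by rewrite -(lookup_values w' iJ) vE lookup_values.
Qed.

Lemma depends_on_measurable J A : depends_on J A -> measurable A.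
Proof.
by move=> /depends_on_preimage ->; apply: discrete_preimage; exact: values_measurable.
Qed.

(** Events determined by finitely many countable values reduce to single values; for these the
    product over the union of two disjoint index sets splits. *)
Lemma depends_on_independent J J' A B : [disjoint J & J']%fset ->
  depends_on J A -> depends_on J' B -> (P (A `&` B) = P A * P B)%E.
Proof.
move=> JJ' /depends_on_preimage -> /depends_on_preimage ->.
apply: measure_independent; [exact: values_measurable..|] => s s'.
have [sz|sz] := pselect (size s = #|` J|); last first.
  by rewrite values_set0 // set0I measure0 mul0e.
have [sz'|sz'] := pselect (size s' = #|` J'|); last first.
  by rewrite (values_set0 sz') setI0 measure0 mule0.
pose a i := if i \in J then lookup J s i else lookup J' s' i.
have aJ' i : i \in J' -> a i = lookup J' s' i.
  move=> iJ'; rewrite /a; case: ifP => // iJ.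
  by have /fdisjointP/(_ i iJ) := JJ'; rewrite iJ'.
have -> : [set w | values J w = s] `&` [set w | values J' w = s'] =
    \bigcap_(i in [set` (J `|` J')%fset]) [set w | V i w = a i].
  rewrite !values_setE //; apply/seteqP; split => w /=.
    move=> [H H'] i /=; rewrite inE => /orP[iJ|iJ'].
      by rewrite /a iJ; exact: H.
    by rewrite aJ' //; exact: H'.
  move=> H; split => i /= iJ.
    by have := H i; rewrite /= inE iJ /a iJ; apply.
  by rewrite -aJ' //; apply: H; rewrite /= inE iJ orbT.
rewrite !values_law // indF //.
have pe : perm_eq (enum_fset (J `|` J')%fset) (enum_fset J ++ enum_fset J').
  apply: uniq_perm; first exact: fset_uniq.
    rewrite cat_uniq !fset_uniq /= andbT; apply/hasPn => i iJ'.
    by apply/negP => iJ; have /fdisjointP/(_ i iJ) := JJ'; rewrite iJ'.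
  by move=> i; rewrite mem_cat -[LHS]/(i \in (J `|` J')%fset) in_fsetU.
rewrite (perm_big _ pe) big_cat /=; congr (_ * _)%E; apply: eq_big_seq => i iJ.
  by rewrite /a iJ.
by rewrite aJ'.
Qed.

End Values.

(** By independence both joint laws on [J] are products of marginals, and the marginals agree. *)
Lemma same_law_depends (F F' : I -> set (set Om)) (V W : I -> Om -> nat)
    (J : {fset I}) (A : set (I -> nat)) :
  mutually_independent P F -> (forall i a, F i [set w | V i w = a]) ->
  mutually_independent P F' -> (forall i a, F' i [set w | W i w = a]) ->
  (forall i, discrete_mfun (V i)) -> (forall i, discrete_mfun (W i)) ->
  (forall i a, i \in J -> P [set w | V i w = a] = P [set w | W i w = a]) ->
  (forall f g, (forall i, i \in J -> f i = g i) -> A f -> A g) ->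
  P [set w | A (V ^~ w)] = P [set w | A (W ^~ w)].
Proof.
move=> indF FV indF' FW mV mW law JA.
have E (Y : I -> Om -> nat) : [set w | A (Y ^~ w)] =
    values Y J @^-1` [set s | A (lookup J s)].
  apply/seteqP; split => w; apply: JA => i iJ; first by rewrite lookup_values.
  by rewrite lookup_values.
rewrite !E; set S := [set s | _].
have := @measure_same_law _ _ _ P _ (values V J) (values W J) setT 1 S.
rewrite setTI mul1e; apply => //; [exact: values_measurable..|] => s.
rewrite setTI mul1e.
have [sz|sz] := pselect (size s = #|` J|); last by rewrite !values_set0.
rewrite (values_law indF FV) // (values_law indF' FW) //.
by apply: eq_big_seq => i iJ; exact: law.
Qed.

End Independence.

(** * Boxes of consumed inputs and their shifts *)

Section SourceBox.
Context (n : nat).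

Definition below (A S D : 'I_n -> nat) (u : nat) (i : source n) : bool :=
  match i with
  | Arrival j t => (t < A j)%N
  | Service j k => (k < S j)%N
  | Routing j k => (k < D j)%N
  | Seed t => (t < u)%N
  end.

Definition source_box (A S D : 'I_n -> nat) (u : nat) : {fset source n} :=
  [fset i in [seq Arrival j t | j <- enum 'I_n, t <- iota 0 (A j)] ++
             [seq Service j t | j <- enum 'I_n, t <- iota 0 (S j)] ++
             [seq Routing j t | j <- enum 'I_n, t <- iota 0 (D j)] ++
             [seq Seed n t | t <- iota 0 u]]%fset.

Lemma in_source_box A S D u i : (i \in source_box A S D u) = below A S D u i.
Proof.
rewrite !inE /=; apply/idP/idP.
  case/or4P => [/allpairsPdep[j [t [_]]]|/allpairsPdep[j [t [_]]]|
      /allpairsPdep[j [t [_]]]|/mapP[t]]; rewrite mem_iota => /andP[_ tA] -> //.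
case: i => [j t|j t|j t|t] /= H; apply/or4P.
- by apply: Or41; apply/allpairsPdep; exists j, t; rewrite mem_enum mem_iota.
- by apply: Or42; apply/allpairsPdep; exists j, t; rewrite mem_enum mem_iota.
- by apply: Or43; apply/allpairsPdep; exists j, t; rewrite mem_enum mem_iota.
- by apply: Or44; apply/mapP; exists t; rewrite // mem_iota.
Qed.

Definition shift_source (t : nat) (s d : 'I_n -> nat) (i : source n) : source n :=
  match i with
  | Arrival j k => Arrival j (t + k)
  | Service j k => Service j (s j + k)
  | Routing j k => Routing j (d j + k)
  | Seed k => Seed n (t + k)
  end.

Lemma shift_source_inj t s d : injective (shift_source t s d).
Proof.
case=> [j k|j k|j k|k] [j' k'|j' k'|j' k'|k'] //= [] => [E|E|E|];
  by rewrite ?E => /addnI ->.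
Qed.

End SourceBox.

(** * The Markov property of the queue lengths *)

Section NetworkMarkov.
Context (d dU : measure_display) (Om : measurableType d)
  (U : measurableType dU) (R : realType) (P : probability Om R) (n : nat).
Variables (N : network R n) (X : inputs U P n)
  (pol : queue_vec n -> U -> queue_vec n).
Hypothesis hX : inputs_law N X.
Hypothesis hpol : maxweight_policy N pol.

Let Z := queue_process X pol.
Let srv := service X pol.
Let dep := departures X pol.

(* The code of the seed at time t is the schedule chosen in state [y t]. *)
Definition source_value (y : nat -> queue_vec n) (i : source n) (w : Om) : nat :=
  match i with
  | Arrival j t => ext_arrivals X j t w
  | Service j k => completes X j k w
  | Routing j k => choice.pickle (routed X j k w)
  | Seed t => choice.pickle (pol (y t) (seed X t w))
  end.

Lemma choice_measurable (q : queue_vec n) (a : nat) :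
  measurable [set u | choice.pickle (pol q u) = a].
Proof.
have [[s <-]|ns] := pselect (exists s : queue_vec n, choice.pickle s = a).
  rewrite (_ : [set u | _] = [set u | pol q u = s]).
    exact: (policy_measurable hpol).
  apply/seteqP; split => u /= => [|-> //].
  exact: (pcan_inj (@choice.pickleK _)).
rewrite (_ : [set u | _] = set0) //; apply/seteqP; split => // u /= ua.
by apply: ns; exists (pol q u).
Qed.

Lemma source_value_event y i a : source_events X i [set w | source_value y i w = a].
Proof.
case: i => [j t|j k|j k|t] /=.
- by exists [set a]; rewrite ?setTI.
- by exists [set b : bool | nat_of_bool b = a]; rewrite ?setTI.
- by exists [set b : destination n | choice.pickle b = a]; rewrite ?setTI.
- exists [set u | choice.pickle (pol (y t) u) = a]; rewrite ?setTI //.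
  exact: choice_measurable.
Qed.

Lemma source_event_measurable i A : source_events X i A -> measurable A.
Proof.
by case: i => [j t|j k|j k|t] /= [B mB <-]; rewrite setTI;
  exact: measurable_funPTI.
Qed.

Lemma source_value_measurable y i : discrete_mfun (source_value y i).
Proof. by move=> a; apply/source_event_measurable/source_value_event. Qed.

(** The law of the inputs prescribes only the probabilities of [Some i]; that of leaving follows by
    complement. *)
Lemma routed_None_law j k :
  P (routed X j k @^-1` [set None]) = P (routed X j 0%N @^-1` [set None]).
Proof.
have mr k' (o : destination n) : measurable (routed X j k' @^-1` [set o]).
  exact: measurable_funPTI.
have E k' : routed X j k' @^-1` [set None] =
    ~` \bigcup_(i in [set: 'I_n]) (routed X j k' @^-1` [set Some i]).
  apply/seteqP; split => w /=; first by move=> rN [i _ /=]; rewrite rN.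
  by case E : (routed X j k' w) => [i|//] []; exists i.
rewrite !E !probability_setC; last 2 first.
- by apply: fin_bigcup_measurable.
- by apply: fin_bigcup_measurable.
have tr k' : trivIset [set: 'I_n] (fun i => routed X j k' @^-1` [set Some i]).
  by move=> i i' _ _ [w [/= ri]]; rewrite ri => -[].
congr (_ - _)%E; rewrite !measure_fin_bigcup //; try exact: finite_finset.
apply: eq_fsbigr => i _.
exact: etrans (routed_law hX j k i) (esym (routed_law hX j 0%N i)).
Qed.

(** The state is frozen at [q], which makes the coded choices of the policy identically distributed
    over time. *)
Lemma source_value_shift_law q t s dd i a :
  P [set w | source_value (fun=> q) (shift_source t s dd i) w = a] =
  P [set w | source_value (fun=> q) (shift_source 0%N (fun=> 0%N) (fun=> 0%N) i) w = a].
Proof.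
have point_laws (C : countType) (e : C -> nat) (Y Y' : Om -> C) :
    discrete_mfun Y -> discrete_mfun Y' ->
    (forall c, P (Y @^-1` [set c]) = P (Y' @^-1` [set c])) ->
    P [set w | e (Y w) = a] = P [set w | e (Y' w) = a].
  move=> mY mY' law.
  have := @measure_same_law _ _ _ P _ Y Y' setT 1 [set c | e c = a] mY mY'.
  rewrite mul1e setTI; apply => // c; rewrite setTI mul1e; exact: law.
case: i => [j k|j k|j k|k] /=.
- have law k' := @ext_arrivals_law _ _ _ _ _ _ _ _ _ hX j k' [set a] I.
  exact: etrans (law (t + k)%N) (esym (law (0 + k)%N)).
- apply: point_laws => [c|c|b].
      exact: (measurable_funPTI (completes X j (s j + k)%N) (Y := [set c])).
    exact: (measurable_funPTI (completes X j (0 + k)%N) (Y := [set c])).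
  have law c k' : P (completes X j k' @^-1` [set c]) =
      P (completes X j 0%N @^-1` [set c]).
    have E k'' : completes X j k'' @^-1` [set false] =
        ~` (completes X j k'' @^-1` [set true]).
      by apply/seteqP; split => w /=; case: (completes X j k'' w).
    have T k'' : P (completes X j k'' @^-1` [set true]) =
        P (completes X j 0%N @^-1` [set true]).
      exact: etrans (completes_law hX j k'') (esym (completes_law hX j 0%N)).
    case: c => //; rewrite !E !probability_setC; [|exact: measurable_funPTI..].
    by rewrite T.
  by rewrite (law b (s j + k)%N) (law b (0 + k)%N).
- apply: (point_laws (option 'I_n)) => [c|c|[j'|]].
      exact: (measurable_funPTI (routed X j (dd j + k)%N) (Y := [set c])).
    exact: (measurable_funPTI (routed X j (0 + k)%N) (Y := [set c])).
    exact: etrans (routed_law hX j (dd j + k) j') (esym (routed_law hX j (0 + k) j')).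
  by rewrite (routed_None_law j (dd j + k)) (routed_None_law j (0 + k)).
- have law k' := @seed_law _ _ _ _ _ _ _ _ _ hX k' _ (choice_measurable q a).
  exact: etrans (law (t + k)%N) (esym (law (0 + k)%N)).
Qed.

Definition next_completions (q : queue_vec n) (v : source n -> nat) (i : 'I_n) : nat :=
  let s : queue_vec n := odflt [ffun=> 0%N] (choice.unpickle (v (Seed n 0))) in
  (\sum_(k < minn (s i) (q i)) (v (Service i k) != 0))%N.

(** One time step as a function of coded inputs numbered from 0; combined with [shift_source], the
    same function serves every step. *)
Definition next_state (q : queue_vec n) (v : source n -> nat) : queue_vec n :=
  [ffun j => q j + v (Arrival j 0) +
     \sum_i \sum_(k < next_completions q v i)
        (v (Routing i k) == choice.pickle (Some j : option 'I_n))
     - next_completions q v j]%N.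

Lemma next_completions_le (q : queue_vec n) v i : (next_completions q v i <= q i)%N.
Proof.
apply: (@leq_trans (minn (odflt [ffun=> 0%N] (choice.unpickle (v (Seed n 0))) i) (q i))).
  rewrite -[leqRHS]card_ord -sum1_card; apply: leq_sum => k _; exact: leq_b1.
exact: geq_minr.
Qed.

(** At most [q i] units of service are given at i and at most [q i] jobs leave it, so one step reads
    a finite box, as independence of finite families requires. *)
Lemma next_state_local (q : queue_vec n) (v v' : source n -> nat) :
  (forall i, i \in source_box (fun=> 1%N) q q 1 -> v i = v' i) ->
  next_state q v = next_state q v'.
Proof.
move=> vv'; have cE i : next_completions q v i = next_completions q v' i.
  rewrite /next_completions -(vv' (Seed n 0)) ?in_source_box //.
  apply: eq_bigr => k _; rewrite vv' // in_source_box /=.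
  exact: leq_trans (geq_minr _ _).
apply/ffunP => j; rewrite !ffunE -vv' ?in_source_box // -cE; congr (_ + _ - _)%N.
apply: eq_bigr => i _; rewrite -cE; apply: eq_bigr => k _.
rewrite vv' // in_source_box /=; exact: leq_trans (next_completions_le q v i).
Qed.

Let srvD x t w j : srv x t.+1 w j =
  (srv x t w j + minn (pol (Z x t w) (seed X t w) j) (Z x t w j))%N.
Proof. by rewrite /srv /= ffunE. Qed.

Lemma queue_step x t w :
  Z x t.+1 w = next_state (Z x t w) (fun i => source_value (fun=> Z x t w)
    (shift_source t (srv x t w) (dep x t w) i) w).
Proof.
set q := Z x t w.
pose v i := source_value (fun=> q) (shift_source t (srv x t w) (dep x t w) i) w.
rewrite -[RHS]/(next_state q v).
pose c := next_completions q v.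
have depE j : dep x t.+1 w j = (dep x t w j + c j)%N.
  have dE u : dep x u w j = completions X j (srv x u w j) w.
    by rewrite /dep /departures ffunE.
  rewrite !dE srvD /completions big_split_ord.
  congr (_ + _)%N; rewrite /c /next_completions {1}/v /source_value /shift_source.
  rewrite choice.pickleK addn0; apply: eq_bigr => k _.
  by rewrite /v /=; case: (completes X j _ w).
have routedE i j : routed_jobs X i j (dep x t.+1 w i) w =
   (routed_jobs X i j (dep x t w i) w + \sum_(k < c i)
        (v (Routing i k) == choice.pickle (Some j : option 'I_n)))%N.
  rewrite depE /routed_jobs big_split_ord /=; congr (_ + _)%N.
  apply: eq_bigr => k _; congr (nat_of_bool _).
  by rewrite /v /= (inj_eq (pcan_inj (@choice.pickleK _))).
apply/ffunP => j; rewrite [RHS]ffunE -/(c j) -/c.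
have := queue_balance X pol x t.+1 w j; have := queue_balance X pol x t w j.
rewrite /arrivals (eq_bigr _ (fun i _ => routedE i j)) big_split /= -/(dep x t.+1 w).
rewrite depE -/(dep x t w) /external_arrivals big_ord_recr /=.
rewrite -/(Z x t.+1 w) -/(Z x t w) -/q /v /= addn0.
(* The two balance equations determine the new queue length despite the truncated subtraction in
   [next_state]. *)
set r := (\sum_i \sum_(_ < _) _)%N; lia.
Qed.

Lemma service_mono x t t' w j : (t <= t')%N -> (srv x t w j <= srv x t' w j)%N.
Proof.
move=> /subnKC <-; elim: (t' - t)%N => [|k IH]; first by rewrite addn0.
by rewrite addnS srvD (leq_trans IH) // leq_addr.
Qed.

Lemma departures_mono x t t' w j : (t <= t')%N -> (dep x t w j <= dep x t' w j)%N.
Proof.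
by move=> tt'; rewrite /dep !ffunE; apply: completions_mono; exact: service_mono.
Qed.

Lemma queue_process0 x w : Z x 0%N w = x.
Proof.
apply/ffunP => j; have d0 i : dep x 0 w i = 0%N.
  by rewrite /dep /departures ffunE /= ffunE /completions big_ord0.
have := queue_balance X pol x 0 w j; rewrite -/(dep x 0 w) d0 addn0 => ->.
rewrite /arrivals /external_arrivals big_ord0 big1 ?addn0 // => i _.
by rewrite d0 /routed_jobs big_ord0.
Qed.

Lemma history_nth x t w s : (s <= t)%N ->
  Z x s w = nth x (history Z x t w) (t - s).
Proof.
elim: t => [|t IH]; first by rewrite leqn0 => /eqP ->; exact: queue_process0.
rewrite leq_eqVlt => /predU1P [->|st]; first by rewrite subnn.
by rewrite subSn //=; exact: IH.
Qed.

Lemma history_size x t w : size (history Z x t w) = t.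
Proof. by elim: t => //= t ->. Qed.

(** The history lists states backwards; at [s = 0] the index falls past its end, and the default [x]
    is the initial state. *)
Definition past_states (x : queue_vec n) (l : seq (queue_vec n)) (s : nat) :=
  nth x l (size l - s).

(** The totals of service and departures are fixed along with the history because they tell which
    inputs have been consumed. *)
Definition past_event x t (l : seq (queue_vec n)) (s dd : queue_vec n) : set Om :=
  [set w | [/\ history Z x t w = l, srv x t w = s & dep x t w = dd]].

Let queueE x t w j :
  Z x t w j = (x j + arrivals X (dep x t w) j t w - dep x t w j)%N.
Proof. by rewrite /Z /queue_process /queue_after ffunE. Qed.

(** Induction on time: two outcomes that agree on the box produce the same run, since by
    monotonicity no step before [t] reads beyond the totals [s] and [dd]. *)
Lemma past_event_depends x t l (s dd : queue_vec n) :
  depends_on (source_value (past_states x l)) (source_box (fun=> t) s dd t)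
    (past_event x t l s dd).
Proof.
move=> w w' ww' [hl hs hd].
have tl : size l = t by rewrite -hl history_size.
have yE k : (k <= t)%N -> past_states x l k = Z x k w.
  by move=> kt; rewrite /past_states tl -hl -history_nth.
have vA j k : (k < t)%N -> ext_arrivals X j k w = ext_arrivals X j k w'.
  by move=> kt; have := ww' (Arrival j k); rewrite in_source_box /=; apply.
have vS j k : (k < s j)%N -> completes X j k w = completes X j k w'.
  move=> kt; have := ww' (Service j k); rewrite in_source_box /= => /(_ kt).
  by case: (completes X j k w) (completes X j k w') => [] [].
have vR j k : (k < dd j)%N -> routed X j k w = routed X j k w'.
  move=> kt; have := ww' (Routing j k); rewrite in_source_box /= => /(_ kt).
  exact: (pcan_inj (@choice.pickleK _)).
have vU k : (k < t)%N -> pol (Z x k w) (seed X k w) = pol (Z x k w) (seed X k w').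
  move=> kt; have := ww' (Seed n k); rewrite in_source_box /= (yE _ (ltnW kt)) => /(_ kt).
  exact: (pcan_inj (@choice.pickleK _)).
have depE k : (k <= t)%N -> srv x k w = srv x k w' -> dep x k w = dep x k w'.
  move=> kt sE; apply/ffunP => j; rewrite /dep !ffunE -/srv -sE.
  apply: eq_bigr => i _; rewrite vS // -hs.
  by apply: leq_trans (service_mono x w j kt); exact: ltn_ord.
have ZE k : (k <= t)%N -> srv x k w = srv x k w' -> Z x k w = Z x k w'.
  move=> kt sE; have dE := depE k kt sE; apply/ffunP => j.
  rewrite !queueE -dE; congr (_ + _ - _)%N; rewrite /arrivals; congr (_ + _)%N.
    by apply: eq_bigr => i _; rewrite vA //; exact: leq_trans kt.
  apply: eq_bigr => i _; apply: eq_bigr => m _; rewrite vR // -hd.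
  by apply: leq_trans (departures_mono x w i kt); exact: ltn_ord.
have sE k : (k <= t)%N -> srv x k w = srv x k w'.
  elim: k => [|k IH] kt //; apply/ffunP => j; rewrite !srvD IH ?(ltnW kt) //.
  by rewrite -ZE ?IH ?(ltnW kt) // vU.
split.
- rewrite -hl; have : forall k, (k <= t)%N -> Z x k w = Z x k w'.
    by move=> k kt; apply: ZE => //; exact: sE.
  elim: (t) => //= k IH ZZ; rewrite IH => [|i ik]; last by apply: ZZ; exact: leqW.
  by rewrite -ZZ.
- by rewrite -sE.
- by rewrite -depE // sE.
Qed.

Lemma past_measurable x t :
  discrete_mfun (fun w => (history Z x t w, (srv x t w, dep x t w))).
Proof.
move=> [l [s dd]]; rewrite (_ : [set w | _] = past_event x t l s dd).
  have := @past_event_depends x t l s dd; apply: depends_on_measurable.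
  exact: source_value_measurable.
by apply/seteqP; split => w /= => [[<- <- <-]|[-> -> ->]].
Qed.

Lemma queue_process_measurable x t : discrete_mfun (Z x t).
Proof.
rewrite (_ : Z x t = (fun p => head x p.1) \o
    (fun w => (history Z x t w, (srv x t w, dep x t w)))).
  by apply: discrete_comp; exact: past_measurable.
by apply/funext => w /=; rewrite -nth0 -[in X in nth _ _ X](subnn t) -history_nth.
Qed.

Lemma next_state_law q (s dd : queue_vec n) t y :
  P [set w | next_state q
      (fun i => source_value (fun=> q) (shift_source t s dd i) w) = y] =
  P [set w | Z q 1%N w = y].
Proof.
pose sh0 : source n -> source n := shift_source 0%N (fun=> 0%N) (fun=> 0%N).
have -> : [set w | Z q 1%N w = y] =
    [set w | next_state q (fun i => source_value (fun=> q) (sh0 i) w) = y].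
  have E w : Z q 1%N w = next_state q (fun i => source_value (fun=> q) (sh0 i) w).
    rewrite queue_step queue_process0; apply: next_state_local => i _.
    congr (source_value _ _ w); case: i => [j k|j k|j k|k] //=.
      by rewrite ffunE.
    by rewrite /dep /departures ffunE /= ffunE /completions big_ord0.
  by apply/seteqP; split => w /=; rewrite E.
have ev (sh : source n -> source n) i a :
    (source_events X \o sh) i [set w | source_value (fun=> q) (sh i) w = a].
  exact: source_value_event.
have meas sh (i : source n) : discrete_mfun (source_value (fun=> q) (sh i)).
  exact: source_value_measurable.
have := @same_law_depends _ _ _ P _ _ _
  (fun i => source_value (fun=> q) (shift_source t s dd i))
  (fun i => source_value (fun=> q) (sh0 i))
  (source_box (fun=> 1%N) q q 1) [set v | next_state q v = y]
  _ (ev (shift_source t s dd)) _ (ev sh0).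
apply.
- apply: mutually_independent_reindex (inputs_independent hX).
  exact: shift_source_inj.
- apply: mutually_independent_reindex (inputs_independent hX).
  exact: shift_source_inj.
- exact: meas.
- exact: meas.
- by move=> i a _; exact: source_value_shift_law.
- by move=> f g fg /=; rewrite (next_state_local fg).
Qed.

(** The past reads one box, the next state a shifted box that starts where the first ends; being
    disjoint, they are independent. *)
Lemma past_event_step x t l (s dd y : queue_vec n) :
  (P (past_event x t l s dd `&` [set w | Z x t.+1 w = y]) =
   P (past_event x t l s dd) * P [set w | Z (head x l) 1%N w = y])%E.
Proof.
have [tl|tl] := pselect (size l = t); last first.
  rewrite (_ : past_event x t l s dd = set0) ?set0I ?measure0 ?mul0e //.
  by apply/seteqP; split => // w [hl _ _]; apply: tl; rewrite -hl history_size.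
set q := head x l; set ps := past_states x l.
have ps_t : ps t = q by rewrite /ps /past_states tl subnn nth0.
pose sh := shift_source t s dd.
(* The only seed read is that of time [t], where [ps] and the constant [q] agree. *)
have local w : next_state q (fun i => source_value ps (sh i) w) =
               next_state q (fun i => source_value (fun=> q) (sh i) w).
  apply: next_state_local => -[j k|j k|j k|k]; rewrite in_source_box //= ltnS leqn0.
  by move=> /eqP ->; rewrite addn0 ps_t.
pose G := [set w | next_state q (fun i => source_value ps (sh i) w) = y].
have -> : past_event x t l s dd `&` [set w | Z x t.+1 w = y] =
          past_event x t l s dd `&` G.
  have E w : past_event x t l s dd w -> Z x t.+1 w =
      next_state q (fun i => source_value ps (sh i) w).
    move=> [hl hs hd]; rewrite local queue_step.
    have -> : Z x t w = q by rewrite /q -hl -nth0 -[in RHS](subnn t) -history_nth.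
    by rewrite /srv -/srv hs hd.
  by apply/seteqP; split => w [pw]; rewrite /G /= (E w).
rewrite -(next_state_law q s dd t y).
have -> : [set w | next_state q
    (fun i => source_value (fun=> q) (shift_source t s dd i) w) = y] = G.
  by apply/seteqP; split => w; rewrite /G /= local.
apply: (@depends_on_independent _ _ _ P _ (source_events X) (source_value ps)
   (inputs_independent hX) _ _ (source_box (fun=> t) s dd t)
   (sh @` source_box (fun=> 1%N) q q 1)%fset).
- exact: source_value_event.
- exact: source_value_measurable.
- apply/fdisjointP => i; rewrite in_source_box => ib; apply/imfsetP => -[i' /= _ iE].
  by move: ib; rewrite iE; case: i' {iE} => [j k|j k|j k|k] /=; rewrite ltnNge leq_addr.
- exact: past_event_depends.
- move=> w w' ww'; rewrite /G /= => <-; apply: next_state_local => i ib.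
  by apply/esym/ww'; rewrite in_imfset.
Qed.

Theorem queue_process_markov : markov_family P Z.
Proof.
split; [exact: queue_process_measurable|exact: queue_process0|].
move=> x t l y; pose Y w := (srv x t w, dep x t w).
have mY : discrete_mfun Y := discrete_comp (fun p => p.2) (past_measurable x t).
have mH : measurable [set w | history Z x t w = l].
  exact: (discrete_comp (fun p => p.1) (past_measurable x t)).
have mZy : measurable [set w | Z x t.+1 w = y] by exact: queue_process_measurable.
(* The totals of service and departures are summed out, leaving the history alone. *)
rewrite (measure_discrete_split P mY); last exact: measurableI.
rewrite [X in (X * _)%E](measure_discrete_split P mY) //.
have mq : measurable [set w | Z (head x l) 1%N w = y] by exact: queue_process_measurable.
rewrite muleC -(fineK (fin_num_measure P _ mq)) -nneseriesZl //.
apply: eq_eseriesr => k _.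
have [[[s dd] <-]|nk] := pselect
    (exists c : queue_vec n * queue_vec n, choice.pickle c = k); last first.
  have E D : D `&` [set w | choice.pickle (Y w) = k] = set0.
    by apply/seteqP; split => // w [_ /= wk]; apply: nk; exists (Y w).
  by rewrite !E measure0 mule0.
have YE : [set w | choice.pickle (Y w) = choice.pickle (s, dd)] = [set w | Y w = (s, dd)].
  by apply/seteqP; split => w /= => [|-> //]; exact: (pcan_inj (@choice.pickleK _)).
have pE : [set w | history Z x t w = l] `&` [set w | Y w = (s, dd)] =
    past_event x t l s dd.
  apply/seteqP; split => w; first by move=> [hl [hs hd]].
  by move=> [hl hs hd]; split => //=; rewrite /Y hs hd.
rewrite YE setIAC pE past_event_step fineK ?fin_num_measure //.
by rewrite muleC.
Qed.

End NetworkMarkov.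

(** * Law of large numbers with maximal deviations *)

Section LawOfLargeNumbers.
Context (d : measure_display) (Om : measurableType d) (R : realType)
  (P : probability Om R).

Lemma integral_ge0_sum (n : nat) (f : nat -> Om -> R) :
  (forall k, measurable_fun setT (f k)) -> (forall k w, 0 <= f k w) ->
  (\int[P]_w (\sum_(k < n) f k w)%:E = \sum_(k < n) \int[P]_w (f k w)%:E)%E.
Proof.
move=> mf f0; under eq_integral do rewrite -sumEFin.
rewrite ge0_integral_sum //; first by move=> k; exact/measurable_EFinP.
by move=> k w _; rewrite lee_fin.
Qed.

(** Pairwise independence bounds the variance of the sum by [N]; |z| <= D + z^2 / D with D = delta N
    then gives the first moment. *)
Lemma bernoulli_sum_deviation (A : nat -> set Om) (p : R) (N : nat) (delta : R) :
  (forall k, measurable (A k)) -> (forall k, P (A k) = p%:E) ->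
  (forall k l, k != l -> P (A k `&` A l) = (P (A k) * P (A l))%E) ->
  0 < delta ->
  (\int[P]_w `|\sum_(k < N) (\1_(A k) w - p)|%:E <=
   (delta * N%:R + delta^-1)%:E)%E.
Proof.
move=> mA PA indA delta0.
have [->|N0] := posnP N.
  rewrite (eq_integral (fun=> 0%E)) => [|w _]; last by rewrite big_ord0 normr0.
  by rewrite integral0 lee_fin mulr0 add0r invr_ge0 ltW.
have NR : 0 < N%:R :> R by rewrite ltr0n.
have p0 : 0 <= p by rewrite -lee_fin -(PA 0%N).
pose S w : R := \sum_(k < N) \1_(A k) w.
have mI k : measurable_fun setT (\1_(A k) : Om -> R) by exact: measurable_indic.
have mS : measurable_fun setT S by apply: measurable_sum => k; exact: mI.
have S0 w : 0 <= S w by apply: sumr_ge0 => k _; rewrite indicE.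
have ES : (\int[P]_w (S w)%:E = (N%:R * p)%:E)%E.
  rewrite /S (@integral_ge0_sum N (fun k => \1_(A k))) //.
  rewrite (eq_bigr (fun=> p%:E)) => [|k _].
    by rewrite sumEFin sumr_const card_ord mulr_natl.
  by rewrite integral_indic // setIT; exact: PA.
pose z w := S w - N%:R * p.
have mz : measurable_fun setT z by apply: measurable_funB.
have sq0 (x : R) : (0 <= (x ^+ 2)%:E)%E by rewrite lee_fin sqr_ge0.
have mz2 : measurable_fun setT (fun w => z w ^+ 2) by exact: measurable_funX.
have mS2 : measurable_fun setT (fun w => S w ^+ 2) by exact: measurable_funX.
have ES2 : (\int[P]_w (S w ^+ 2)%:E <= (N%:R * p + N%:R ^+ 2 * p ^+ 2)%:E)%E.
  under eq_integral => w _.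
    rewrite expr2 {1}/S mulr_suml.
    over.
  rewrite (@integral_ge0_sum N (fun k w => \1_(A k) w * S w)); last 2 first.
  - by move=> k; exact: measurable_funM.
  - by move=> k w; rewrite mulr_ge0 // indicE.
  apply: (@le_trans _ _ (\sum_(k < N) (p + N%:R * p ^+ 2)%:E)%E); last first.
    rewrite sumEFin lee_fin sumr_const card_ord -mulr_natl; lra.
  apply: lee_sum => k _; under eq_integral => w _.
    rewrite /S mulr_sumr.
    over.
  rewrite (@integral_ge0_sum N (fun l w => \1_(A k) w * \1_(A l) w)); last 2 first.
  - by move=> l; exact: measurable_funM.
  - by move=> l w; rewrite mulr_ge0 // indicE.
  have E l : (\int[P]_w (\1_(A k) w * \1_(A l) w)%:E = P (A k `&` A l))%E.
    transitivity (\int[P]_w (\1_(A k `&` A l) w)%:E)%E.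
      by apply: eq_integral => w _; rewrite indicI.
    by rewrite integral_indic ?setIT //; exact: measurableI.
  rewrite (bigD1 k) //= E setIid PA EFinD leeD2l //.
  apply: (@le_trans _ _ (\sum_(l < N | l != k) (p ^+ 2)%:E)%E).
    by apply: lee_sum => l lk; rewrite E indA 1?eq_sym // !PA -EFinM expr2.
  rewrite sumEFin lee_fin sumr_const -[leLHS]mulr_natl ler_wpM2r ?sqr_ge0 // ler_nat.
  by rewrite (leq_trans (max_card _)) // card_ord.
have P1 : P setT = 1%E by exact: probability_setT.
have Ez2 : (\int[P]_w (z w ^+ 2)%:E <= N%:R%:E)%E.
  pose c := 2 * (N%:R * p); have c0 : 0 <= c by rewrite !mulr_ge0.
  have c0E : (0 <= c%:E)%E by rewrite lee_fin.
  have mzE : measurable_fun setT (fun w => (z w ^+ 2)%:E) by exact/measurable_EFinP.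
  have mSE : measurable_fun setT (fun w => (S w)%:E) by exact/measurable_EFinP.
  have mS2E : measurable_fun setT (fun w => (S w ^+ 2)%:E) by exact/measurable_EFinP.
  have S0E w : setT w -> (0 <= (S w)%:E)%E by rewrite lee_fin.
  (* The cross term of the square is added on both sides, so that only nonnegative functions are
     integrated. *)
  have lhs : (\int[P]_w ((z w ^+ 2)%:E + c%:E * (S w)%:E) =
      \int[P]_w (z w ^+ 2)%:E + c%:E * (N%:R * p)%:E)%E.
    rewrite -ES -(@ge0_integralZl _ _ _ P setT measurableT _ mSE c%:E S0E c0E).
    apply: ge0_integralD => //.
      by move=> w _; rewrite -EFinM lee_fin mulr_ge0.
    by apply: emeasurable_funM.
  have rhs : (\int[P]_w ((S w ^+ 2)%:E + ((N%:R * p) ^+ 2)%:E) =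
      \int[P]_w (S w ^+ 2)%:E + ((N%:R * p) ^+ 2)%:E)%E.
    rewrite ge0_integralD //; congr (_ + _)%E.
    by rewrite integral_cst // -[RHS]mule1; congr (_ * _)%E.
  have E : (\int[P]_w (z w ^+ 2)%:E + c%:E * (N%:R * p)%:E <=
            (N%:R * p + N%:R ^+ 2 * p ^+ 2)%:E + ((N%:R * p) ^+ 2)%:E)%E.
    rewrite -lhs (eq_integral (fun w => ((S w ^+ 2)%:E + ((N%:R * p) ^+ 2)%:E)%E)).
      by rewrite rhs leeD2r.
    move=> w _; rewrite -EFinM -!EFinD; congr EFin; rewrite /z /c; ring.
  move: E; rewrite -EFinM -EFinD -leeBrDr // -EFinB => /le_trans; apply.
  rewrite lee_fin /c.
  have p1 : p <= 1 by rewrite -lee_fin -(PA 0%N) probability_le1.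
  have := ler_wpM2l (ltW NR) p1; lra.
have amgm (D y : R) : 0 < D -> 0 <= y -> y <= D + D^-1 * y ^+ 2.
  move=> D0 y0; have -> : D + D^-1 * y ^+ 2 = (D ^+ 2 + y ^+ 2) / D.
    by field; rewrite gt_eqF.
  rewrite ler_pdivlMr //.
  have := sqr_ge0 (y - D); have := mulr_ge0 (ltW D0) y0; nra.
have absle (x : R) : `|x| <= delta * N%:R + (delta * N%:R)^-1 * x ^+ 2.
  by rewrite -[x ^+ 2]real_normK ?num_real //; apply: amgm; rewrite ?mulr_gt0.
apply: (@le_trans _ _ (\int[P]_w ((delta * N%:R)%:E +
    ((delta * N%:R)^-1)%:E * (z w ^+ 2)%:E))%E).
  apply: ge0_le_integral => //.
  - apply/measurable_EFinP; apply: measurableT_comp => //.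
    apply: measurable_sum => k; apply: measurable_funB => //.
  - apply: emeasurable_funD => //; apply: emeasurable_funM => //.
    exact/measurable_EFinP.
  - move=> w _; rewrite -EFinM -EFinD lee_fin.
    have -> : \sum_(k < N) (\1_(A k) w - p) = z w.
      by rewrite sumrB sumr_const card_ord -mulr_natl.
    exact: absle.
have D0 : 0 <= delta * N%:R by rewrite mulr_ge0 // ltW.
rewrite ge0_integralD //; last 2 first.
- by move=> w _; rewrite -EFinM lee_fin mulr_ge0 ?sqr_ge0 ?invr_ge0.
- by apply: emeasurable_funM => //; exact/measurable_EFinP.
rewrite ge0_integralZl //; try exact/measurable_EFinP; try by rewrite lee_fin invr_ge0.
rewrite EFinD; apply: leeD.
  rewrite integral_cst // -[leRHS]mule1 le_eqVlt; apply/orP; left; apply/eqP.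
  by congr (_ * _)%E.
apply: (@le_trans _ _ (((delta * N%:R)^-1)%:E * N%:R%:E)%E).
  by apply: lee_wpmul2l => //; rewrite lee_fin invr_ge0.
by rewrite -EFinM lee_fin invfM -mulrA mulVf ?mulr1 // gt_eqF.
Qed.

Section Integers.
Variables (X : nat -> Om -> nat) (a : R).
Hypothesis mX : forall k, discrete_mfun (X k).
Hypothesis indX : forall k l i j, k != l ->
  P ([set w | i < X k w]%N `&` [set w | j < X l w]%N) =
  (P [set w | i < X k w]%N * P [set w | j < X l w]%N)%E.
Hypothesis idX : forall k i, P [set w | i < X k w]%N = P [set w | i < X 0 w]%N.
Hypothesis meanX : forall k, (\int[P]_w (X k w)%:R%:E = a%:E)%E.

Let A i k := [set w | i < X k w]%N.

Let mA i k : measurable (A i k).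
Proof. exact: (discrete_preimage [set x | i < x]%N). Qed.

Let p i : R := fine (P (A i 0)).

Let PA i k : P (A i k) = (p i)%:E.
Proof. by rewrite /p fineK ?fin_num_measure //; exact: idX. Qed.

Let p_ge0 i : 0 <= p i.
Proof. by rewrite fine_ge0. Qed.

Let mI i k : measurable_fun setT (\1_(A i k) : Om -> R).
Proof. exact: measurable_indic. Qed.

Let int_indic i k : (\int[P]_w (\1_(A i k) w)%:E = (p i)%:E)%E.
Proof. by rewrite integral_indic // setIT; exact: PA. Qed.

Let mXsub c k : measurable_fun setT (fun w => (X k w - c)%N%:R : R).
Proof. exact: (discrete_measurable_fun (fun x => (x - c)%N%:R : R)). Qed.

(** Layers below level [c] and overshoot: the layers are bounded, hence have second moments, while
    the variables are only assumed to have a mean. *)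
Lemma natr_indic_split (c x : nat) :
  x%:R = \sum_(i < c) (i < x)%N%:R + (x - c)%N%:R :> R.
Proof.
rewrite -natr_sum -natrD; congr _%:R.
elim: c => [|c IH]; first by rewrite big_ord0 add0n subn0.
rewrite big_ord_recr /= {1}IH -addnA; congr (_ + _)%N; case: ltnP; lia.
Qed.

Let indicA i k w : \1_(A i k) w = (i < X k w)%N%:R :> R.
Proof.
rewrite indicE; congr (nat_of_bool _)%:R.
by apply/idP/idP => [/set_mem|H]; rewrite ?mem_set.
Qed.

Let tail c : R := a - \sum_(i < c) p i.

Lemma integral_tail c k : (\int[P]_w (X k w - c)%N%:R%:E = (tail c)%:E)%E.
Proof.
have E : (\int[P]_w (X k w)%:R%:E = (\sum_(i < c) p i)%:E +
    \int[P]_w (X k w - c)%N%:R%:E)%E.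
  rewrite -sumEFin (eq_bigr (fun i : 'I_c => \int[P]_w (\1_(A i k) w)%:E)%E) => [|i _].
    rewrite -(@integral_ge0_sum c (fun i => \1_(A i k))) //.
    have m1 : measurable_fun setT (fun w => (\sum_(i < c) \1_(A i k) w)%:E : \bar R).
      by apply/measurable_EFinP; apply: measurable_sum => i; exact: mI.
    have m2 : measurable_fun setT (fun w => (X k w - c)%N%:R%:E : \bar R).
      exact/measurable_EFinP.
    have s1 w : setT w -> (0 <= (\sum_(i < c) \1_(A i k) w)%:E :> \bar R)%E.
      by rewrite lee_fin sumr_ge0.
    have s2 w : setT w -> (0 <= (X k w - c)%N%:R%:E :> \bar R)%E by rewrite lee_fin.
    rewrite -(ge0_integralD P measurableT s1 m1 s2 m2).
    apply: eq_integral => w _; rewrite -EFinD; congr EFin.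
    rewrite [LHS](natr_indic_split c); congr (_ + _).
    by apply: eq_bigr => i _; rewrite indicA.
  by rewrite int_indic.
move: E; rewrite meanX /tail EFinB.
move: (\int[P]_w _)%E => t aE; by rewrite aE [X in (X - _)%E]addeC addeK.
Qed.

Lemma tail_ge0 c : 0 <= tail c.
Proof.
by rewrite -lee_fin -(integral_tail c 0); apply: integral_ge0 => w _; rewrite lee_fin.
Qed.

(** The mean is the sum of the probabilities [p i]; if every overshoot exceeded [eps] in mean, all
    partial sums would stay below [a - eps]. *)
Lemma tail_small eps : 0 < eps -> exists c, tail c <= eps.
Proof.
move=> eps0; apply: contrapT => no.
have big c : \sum_(i < c) p i <= a - eps.
  rewrite leNgt; apply/negP => lt; apply: no; exists c; rewrite /tail; lra.
have aE : (a%:E = \sum_(0 <= i <oo) (p i)%:E)%E.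
  rewrite -(meanX 0); transitivity (\int[P]_w \sum_(0 <= i <oo) (\1_(A i 0) w)%:E)%E.
    apply: eq_integral => w _.
    rewrite (@nneseries_split _ _ 0%N (X 0 w)); last by move=> k _; rewrite lee_fin.
    rewrite add0n eseries0 ?adde0; last first => [i iX _|].
      by rewrite indicA ltnNge iX.
    rewrite sumEFin; congr EFin.
    rewrite (eq_big_nat _ _ (F2 := fun=> 1)); last by move=> i /= iX; rewrite indicA iX.
    by rewrite sumr_const_nat subn0.
  rewrite integral_nneseries //; last first.
    by move=> i; apply/measurable_EFinP; exact: mI.
  by apply: eq_eseriesr => i _; exact: int_indic.
have : (a%:E <= (a - eps)%:E)%E.
  rewrite aE; apply: lime_le.
    by apply: is_cvg_nneseries => i _ _; rewrite lee_fin.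
  by apply: nearW => c; rewrite sumEFin lee_fin big_mkord.
by rewrite lee_fin; lra.
Qed.

Definition deviation (k : nat) (w : Om) : R :=
  `|(\sum_(l < k) X l w)%N%:R - a * k%:R|.

Lemma deviation_measurable k : measurable_fun setT (deviation k).
Proof.
apply: measurableT_comp => //; apply: measurable_funB => //.
rewrite (_ : (fun w => _) = (fun w => \sum_(l < k) (X l w)%:R)).
  apply: measurable_sum => l.
  exact: (discrete_measurable_fun (fun x => x%:R : R)).
by apply/funext => w; rewrite natr_sum.
Qed.

Lemma deviation_mean eps : 0 < eps -> exists2 C, 0 <= C &
  forall k, (\int[P]_w (deviation k w)%:E <= (eps * k%:R + C)%:E)%E.
Proof.
move=> eps0; have [c tc] : exists c, tail c <= eps / 4 by apply: tail_small; lra.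
pose delta := eps / (2 * (c%:R + 1)).
have cR : 0 < c%:R + 1 :> R by rewrite ltr_wpDl.
have delta0 : 0 < delta by rewrite divr_gt0 // mulr_gt0.
exists (c%:R * delta^-1); first by rewrite mulr_ge0 // invr_ge0 ltW.
move=> k; pose B i w : R := `|\sum_(l < k) (\1_(A i l) w - p i)|.
have mB i : measurable_fun setT (B i).
  apply: measurableT_comp => //; apply: measurable_sum => l.
  exact: measurable_funB.
have bound w : deviation k w <= \sum_(i < c) B i w +
    \sum_(l < k) (X l w - c)%N%:R + k%:R * tail c.
  rewrite /deviation; have -> : (\sum_(l < k) X l w)%N%:R - a * k%:R =
      \sum_(i < c) \sum_(l < k) (\1_(A i l) w - p i) +
      \sum_(l < k) (X l w - c)%N%:R - k%:R * tail c.
    have -> : (\sum_(l < k) X l w)%N%:R =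
        \sum_(l < k) (\sum_(i < c) (i < X l w)%N%:R + (X l w - c)%N%:R) :> R.
      by rewrite natr_sum; apply: eq_bigr => l _; exact: natr_indic_split.
    rewrite big_split exchange_big /=.
    rewrite [in RHS](eq_bigr
      (fun i : 'I_c => \sum_(l < k) (i < X l w)%N%:R - k%:R * p i)).
      by rewrite sumrB -mulr_sumr /tail; ring.
    move=> i _; rewrite sumrB sumr_const card_ord [in RHS]mulr_natl; congr (_ - _).
    by apply: eq_bigr => l _; rewrite indicA.
  apply: le_trans (ler_normB _ _) _; rewrite [X in _ + X <= _]ger0_norm; last first.
    by rewrite mulr_ge0 // tail_ge0.
  rewrite lerD2r; apply: le_trans (ler_normD _ _) _; apply: lerD.
    exact: ler_norm_sum.
  by rewrite ger0_norm // sumr_ge0.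
have m1 : measurable_fun setT (fun w => \sum_(i < c) B i w).
  exact: measurable_sum.
have m2 : measurable_fun setT (fun w => \sum_(l < k) (X l w - c)%N%:R : R).
  by apply: measurable_sum => l; exact: mXsub.
have B0 i w : 0 <= B i w by rewrite normr_ge0.
have kt0 : 0 <= k%:R * tail c by rewrite mulr_ge0 // tail_ge0.
apply: (@le_trans _ _ (\int[P]_w ((\sum_(i < c) B i w)%:E +
    (\sum_(l < k) (X l w - c)%N%:R)%:E + (k%:R * tail c)%:E))%E).
  apply: ge0_le_integral => //.
  - by move=> w _; rewrite lee_fin normr_ge0.
  - by apply/measurable_EFinP; exact: deviation_measurable.
  - apply: emeasurable_funD => //; apply: emeasurable_funD; exact/measurable_EFinP.
  - by move=> w _; rewrite -!EFinD lee_fin.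
have s10 w : setT w -> (0 <= (\sum_(i < c) B i w)%:E)%E.
  by move=> _; rewrite lee_fin sumr_ge0.
have s20 w : setT w -> (0 <= (\sum_(l < k) (X l w - c)%N%:R)%:E :> \bar R)%E.
  by move=> _; rewrite lee_fin sumr_ge0.
have m1E : measurable_fun setT (fun w => (\sum_(i < c) B i w)%:E).
  exact/measurable_EFinP.
have m2E : measurable_fun setT (fun w => (\sum_(l < k) (X l w - c)%N%:R)%:E : \bar R).
  exact/measurable_EFinP.
rewrite ge0_integralD //; last 2 first.
- by move=> w _; rewrite adde_ge0 ?s10 ?s20.
- exact: emeasurable_funD.
rewrite ge0_integralD //.
have -> : (\int[P]_w (k%:R * tail c)%:E = (k%:R * tail c)%:E)%E.
  rewrite integral_cst // -[RHS]mule1; congr (_ * _)%E; exact: probability_setT.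
rewrite (@integral_ge0_sum c B) // (@integral_ge0_sum k (fun l w => (X l w - c)%N%:R)) //.
rewrite [X in (_ + X + _)%E](eq_bigr (fun=> (tail c)%:E)); last first.
  by move=> l _; exact: integral_tail.
apply: (@le_trans _ _ (\sum_(i < c) (delta * k%:R + delta^-1)%:E +
    \sum_(l < k) (tail c)%:E + (k%:R * tail c)%:E)%E).
  apply: leeD2r; apply: leeD2r; apply: lee_sum => i _.
  apply: bernoulli_sum_deviation => // l l' ll'; exact: indX.
rewrite !sumEFin -!EFinD lee_fin !sumr_const !card_ord.
rewrite -(mulr_natl (delta * _ + _)) -(mulr_natl (tail c)).
have cd : c%:R * delta <= eps / 2.
  rewrite /delta mulrA ler_pdivrMr ?mulr_gt0 //.
  have : 0 <= c%:R :> R by []. nra.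
have kR : 0 <= k%:R :> R by [].
have := ler_wpM2r kR cd; have := ler_wpM2l kR tc; nra.
Qed.

(** Partial sums are monotone, so it suffices to control them at [g.+1] grid points of mesh [b]:
    between neighbours the centering moves by at most [a * b]. The sum of the grid deviations plus
    [a * b] serves as [eta]. *)
Lemma maximal_deviation eps : 0 < eps -> exists N0, forall N, (N0 <= N)%N ->
  exists eta : Om -> R, [/\ measurable_fun setT eta, (forall w, 0 <= eta w),
    (forall w k, (k <= N)%N -> deviation k w <= eta w) &
    (\int[P]_w (eta w)%:E <= (eps * N%:R)%:E)%E].
Proof.
move=> eps0.
have a0 : 0 <= a.
  by rewrite -lee_fin -(meanX 0); apply: integral_ge0 => w _; rewrite lee_fin.
(* This many cells bring [a * b] down to a quarter of [eps * N], up to the constant [a]. *)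
pose g := (Num.truncn (4 * a / eps)).+1.
have gR : 0 < g%:R :> R by rewrite ltr0n.
have ag : 4 * a <= eps * g%:R.
  by rewrite -ler_pdivrMl // mulrC; exact/ltW/truncnS_gt.
have [|C C0 HC] := @deviation_mean (eps / (4 * g.+1%:R)).
  by rewrite divr_gt0 // mulr_gt0 // ltr0n.
(* Bounds the terms that do not grow with [N]; half of [eps * N] absorbs them once [N] is large. *)
pose K := eps * g%:R + g.+1%:R * C + a.
exists (Num.truncn (2 * K / eps)).+1 => N N0N.
have KN : 2 * K <= eps * N%:R.
  rewrite -ler_pdivrMl // mulrC; apply: (@le_trans _ _ (Num.truncn (2 * K / eps)).+1%:R).
    exact/ltW/truncnS_gt.
  by rewrite ler_nat.
pose b := (N %/ g).+1.
exists (fun w => \sum_(j < g.+1) deviation (b * j) w + a * b%:R).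
have dev0 k w : 0 <= deviation k w by rewrite normr_ge0.
have ab0 : 0 <= a * b%:R by rewrite mulr_ge0.
have mS : measurable_fun setT (fun w => \sum_(j < g.+1) deviation (b * j) w).
  by apply: measurable_sum => j; exact: deviation_measurable.
split.
- exact: measurable_funD.
- by move=> w; rewrite addr_ge0 // sumr_ge0.
- move=> w k kN; pose j := (k %/ b)%N.
  have kgb : (k < g * b)%N.
    apply: leq_ltn_trans kN _; rewrite mulnC; exact: ltn_ceil.
  have jg : (j < g)%N by rewrite /j ltn_divLR.
  have le1 (i : nat) : (i <= g)%N ->
      deviation (b * i) w <= \sum_(j < g.+1) deviation (b * j) w.
    rewrite -ltnS => ig; rewrite (bigD1 (Ordinal ig)) //= lerDl sumr_ge0 //.
  have jk : (b * j <= k)%N by rewrite mulnC leq_divM.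
  have kj : (k <= b * j.+1)%N by rewrite mulnC; apply/ltnW/ltn_ceil.
  have mono m m' : (m <= m')%N -> (\sum_(l < m) X l w <= \sum_(l < m') X l w)%N.
    by move=> /subnKC <-; rewrite big_split_ord leq_addr.
  have := le1 _ (ltnW jg); have := le1 _ jg.
  rewrite /deviation !ler_norml => /andP[_ up] /andP[lo _].
  have := mono _ _ jk; have := mono _ _ kj; rewrite -!(ler_nat R) => m1 m2.
  have k1 : a * (b * j)%N%:R <= a * k%:R by rewrite ler_wpM2l // ler_nat.
  have k2 : a * k%:R <= a * (b * j.+1)%N%:R by rewrite ler_wpM2l // ler_nat.
  have E : (b * j.+1)%N%:R = (b * j)%N%:R + b%:R :> R by rewrite mulnS addnC natrD.
  rewrite E in k2 up; apply/andP; split; nra.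
- rewrite (eq_integral (fun w =>
      (\sum_(j < g.+1) deviation (b * j) w)%:E + (a * b%:R)%:E)%E); last first.
    by move=> w _; rewrite EFinD.
  rewrite ge0_integralD //; last 2 first.
  + by move=> w _; rewrite lee_fin sumr_ge0.
  + exact/measurable_EFinP.
  rewrite (@integral_ge0_sum g.+1 (fun j => deviation (b * j))) //; last first.
    by move=> j; exact: deviation_measurable.
  have -> : (\int[P]_w (a * b%:R)%:E = (a * b%:R)%:E)%E.
    rewrite integral_cst // -[RHS]mule1; congr (_ * _)%E; exact: probability_setT.
  have bg : (b * g <= N + g)%N by rewrite /b mulSn addnC leq_add2r leq_divM.
  have bgR : b%:R * g%:R <= N%:R + g%:R :> R by rewrite -natrM -natrD ler_nat.
  apply: (@le_trans _ _ (\sum_(j < g.+1) (eps / (4 * g.+1%:R) * (b * g)%N%:R + C)%:E +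
     (a * b%:R)%:E)%E).
    apply: leeD2r; apply: lee_sum => j _; apply: le_trans (HC _) _.
    rewrite lee_fin lerD2r ler_wpM2l ?ler_nat //.
      by rewrite divr_ge0 ?mulr_ge0 // ltW.
    by rewrite leq_mul2l -ltnS ltn_ord orbT.
  rewrite sumEFin -EFinD lee_fin sumr_const card_ord -(mulr_natl (_ + C)) mulrDr mulrA.
  have -> : g.+1%:R * (eps / (4 * g.+1%:R)) = eps / 4 :> R.
    by field; rewrite gt_eqF // ltr0n.
  have abE : a * b%:R <= eps / 4 * N%:R + a.
    have : (b - 1)%N%:R * g%:R <= N%:R :> R.
      by rewrite -natrM ler_nat /b subn1 /= leq_divM.
    have -> : b%:R = (b - 1)%N%:R + 1 :> R by rewrite natr1 subn1.
    have : 0 <= (b - 1)%N%:R :> R by [].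
    move: ((b - 1)%N%:R : R) => b' b'0 b'g.
    have := ler_wpM2r b'0 ag; have := ler_wpM2l (ltW eps0) b'g; lra.
  have := ler_wpM2l (ltW eps0) bgR; rewrite natrM.
  move: KN; rewrite /K; lra.
Qed.

End Integers.

End LawOfLargeNumbers.

(** * Uniform bounds on the noise of the network inputs *)

Section Noise.
Context (d : measure_display) (Om : measurableType d) (R : realType)
  (P : probability Om R).

(** A uniform law of large numbers in mean: one random bound for all indices and all times up to
    [N], of mean o(N). *)
Definition sublinear_noise (I : Type) (D : I -> nat -> Om -> R) : Prop :=
  forall eps, 0 < eps -> exists N0, forall N, (N0 <= N)%N ->
  exists eta : Om -> R, [/\ measurable_fun setT eta, (forall w, 0 <= eta w),
    (forall i w k, (k <= N)%N -> D i k w <= eta w) &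
    (\int[P]_w (eta w)%:E <= (eps * N%:R)%:E)%E].

Lemma sublinear_noise_fin (I : finType) (D : I -> nat -> Om -> R) :
  (forall i, sublinear_noise (fun _ : unit => D i)) -> sublinear_noise D.
Proof.
move=> HD eps eps0.
have e0 : 0 < eps / (#|I|%:R + 1) by rewrite divr_gt0 // ltr_wpDl.
have [N0 HN0] := choice (fun i => HD i _ e0).
exists (\max_i N0 i)%N => N NN0.
have [eta Heta] := choice (fun i => HN0 i N (leq_trans (leq_bigmax i) NN0)).
have meta i : measurable_fun setT (eta i) by case: (Heta i).
have eta0 i w : 0 <= eta i w by case: (Heta i).
exists (fun w => \sum_i eta i w); split.
- exact: measurable_sum.
- by move=> w; exact: sumr_ge0.
- move=> i w k kN; case: (Heta i) => _ _ H _; apply: le_trans (H tt w k kN) _.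
  by rewrite (bigD1 i) //= lerDl sumr_ge0.
- under eq_integral do rewrite -sumEFin.
  rewrite ge0_integral_sum //; last 2 first.
  + by move=> i; exact/measurable_EFinP.
  + by move=> i w _; rewrite lee_fin.
  apply: (@le_trans _ _ (\sum_(i : I) (eps / (#|I|%:R + 1) * N%:R)%:E)%E).
    by apply: lee_sum => i _; case: (Heta i).
  rewrite sumEFin lee_fin sumr_const -[leLHS]mulr_natl.
  have -> : #|{: I}|%:R * (eps / (#|I|%:R + 1) * N%:R) =
     (#|I|%:R / (#|I|%:R + 1)) * (eps * N%:R) :> R by rewrite !mulrA; ring.
  apply: ler_piMl; first by rewrite mulr_ge0 // ltW.
  by rewrite ler_pdivrMr ?mul1r ?lerDl // ltr_wpDl.
Qed.

Lemma sublinear_noise_deviation (X : nat -> Om -> nat) (a : R) :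
  (forall k, discrete_mfun (X k)) ->
  (forall k l i j, k != l ->
    P ([set w | i < X k w]%N `&` [set w | j < X l w]%N) =
    (P [set w | i < X k w]%N * P [set w | j < X l w]%N)%E) ->
  (forall k i, P [set w | i < X k w]%N = P [set w | i < X 0 w]%N) ->
  (forall k, (\int[P]_w (X k w)%:R%:E = a%:E)%E) ->
  sublinear_noise (fun _ : unit => deviation X a).
Proof.
move=> mX indX idX meanX eps eps0.
have [N0 HN0] := maximal_deviation mX indX idX meanX eps0.
exists N0 => N NN0; have [eta [m0 e0 b0 i0]] := HN0 N NN0.
by exists eta; split => // _; exact: b0.
Qed.

Lemma sublinear_noise_bernoulli (Y : nat -> Om -> bool) (a : R) :
  (forall k, measurable [set w | Y k w]) ->
  (forall k l, k != l -> P ([set w | Y k w] `&` [set w | Y l w]) =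
    (P [set w | Y k w] * P [set w | Y l w])%E) ->
  (forall k, P [set w | Y k w] = a%:E) ->
  sublinear_noise (fun _ : unit => deviation (fun k w => Y k w : nat) a).
Proof.
move=> mY indY lawY.
have S0 k i : [set w | i.+1 < Y k w]%N = set0.
  by apply/seteqP; split => // w /=; case: (Y k w).
have S1 k : [set w | 0 < Y k w]%N = [set w | Y k w].
  by apply/seteqP; split => w /=; case: (Y k w).
apply: sublinear_noise_deviation.
- move=> k; have mb : discrete_mfun (Y k).
    case; first by rewrite (_ : [set w | _] = [set w | Y k w]).
    rewrite (_ : [set w | _] = ~` [set w | Y k w]); first exact: measurableC.
    by apply/seteqP; split => w /=; case: (Y k w).
  exact: (discrete_comp nat_of_bool mb).
- move=> k l [|i] [|j] kl; rewrite ?S0 ?S1 ?set0I ?setI0 ?measure0 ?mul0e ?mule0 //.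
  exact: indY.
- by move=> k [|i]; rewrite ?S0 ?S1 // !lawY.
- move=> k; transitivity (\int[P]_w (\1_[set w | Y k w] w)%:E)%E; last first.
    by rewrite integral_indic // setIT; exact: lawY.
  apply: eq_integral => w _; rewrite indicE; congr (nat_of_bool _)%:R%:E.
  by apply/idP/idP => [H|/set_mem //]; rewrite mem_set.
Qed.

End Noise.

Section NetworkNoise.
Context (d dU : measure_display) (Om : measurableType d)
  (U : measurableType dU) (R : realType) (P : probability Om R) (n : nat).
Variables (N : network R n) (X : inputs U P n).
Hypothesis hX : inputs_law N X.

Lemma source_events_pair i i' A A' : i != i' ->
  source_events X i A -> source_events X i' A' -> P (A `&` A') = (P A * P A')%E.
Proof.
move=> ii' iA iA'.
have ni' : i' != i by rewrite eq_sym.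
pose B k := if k == i then A else A'.
have := inputs_independent hX (J := [fset i; i']%fset) (A := B).
rewrite big_fsetU1 ?inE //= big_seq_fset1 /B eqxx (negbTE ni') => <-.
  congr (P _); apply/seteqP; split => w.
    by move=> [Aw A'w] k /=; rewrite !inE => /orP[]/eqP ->; rewrite ?eqxx ?(negbTE ni').
  move=> H; split.
    by have := H i; rewrite /= !inE eqxx; apply.
  by have := H i'; rewrite /= !inE eqxx orbT (negbTE ni'); apply.
by move=> k; rewrite !inE => /orP[]/eqP ->; rewrite ?eqxx ?(negbTE ni').
Qed.

Definition network_deviation (i : 'I_n + 'I_n + 'I_n * 'I_n) : nat -> Om -> R :=
  match i with
  | inl (inl j) => deviation (ext_arrivals X j) (arrival_rate N 0 j)
  | inl (inr j) => deviation (fun k w => completes X j k w : nat) (completion_prob N 0 j)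
  | inr (j, j') => deviation (fun k w => (routed X j k w == Some j') : nat)
      (routing N j j')
  end.

Lemma network_noise : sublinear_noise P network_deviation.
Proof.
apply: sublinear_noise_fin => -[[j|j]|[j j']] /=.
- have arr B t : measurable B ->
      source_events X (Arrival j t) (ext_arrivals X j t @^-1` B).
    by move=> mB; exists B; rewrite ?setTI.
  apply: sublinear_noise_deviation.
  + by move=> k c; exact: (measurable_funPTI (ext_arrivals X j k) (Y := [set c])).
  + move=> k l i i' kl; apply: source_events_pair
      (arr [set x | i < x]%N k _) (arr [set x | i' < x]%N l _) => //.
    by apply: contra kl => /eqP [->].
  + move=> k i.
    by have := @ext_arrivals_law _ _ _ _ _ _ _ _ _ hX j k [set x | i < x]%N; apply.
  + by move=> k; have := ext_arrivals_mean hX j k; rewrite unlock.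
- have ev k : source_events X (Service j k) [set w | completes X j k w].
    by exists [set true]; rewrite ?setTI.
  apply: sublinear_noise_bernoulli.
  + by move=> k; apply: source_event_measurable (ev k).
  + move=> k l kl; apply: source_events_pair (ev k) (ev l).
    by apply: contra kl => /eqP [->].
  + by move=> k; exact: (completes_law hX j k).
- have E k : [set w | routed X j k w == Some j'] = routed X j k @^-1` [set Some j'].
    by apply/seteqP; split => w /= /eqP.
  have ev k : source_events X (Routing j k) [set w | routed X j k w == Some j'].
    by rewrite E; exists [set Some j']; rewrite ?setTI.
  apply: sublinear_noise_bernoulli.
  + by move=> k; apply: source_event_measurable (ev k).
  + move=> k l kl; apply: source_events_pair (ev k) (ev l).
    by apply: contra kl => /eqP [->].
  + by move=> k; rewrite E; exact: (routed_law hX j k j').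
Qed.

End NetworkNoise.

(** * MaxWeight networks *)

Section Capacity.
Context (R : realType) (n : nat).

(** A half-space is convex, so it contains the hull once it contains [A]. *)
Lemma convex_hull_linear_le (A : set 'rV[R]_n) (c : 'I_n -> R) (b : R) :
  (forall y, A y -> \sum_j c j * y 0 j <= b) ->
  forall y, convex_hull A y -> \sum_j c j * y 0 j <= b.
Proof.
move=> HA y /(_ [set y : 'rV[R]_n | \sum_j c j * y 0 j <= b]) H.
apply: H; split=> // u v l /set_mem /= ub /set_mem /= vb.
apply/mem_set => /=.
have [l0 l1] : 0 <= l%:num /\ l%:num <= 1 by [].
have -> : \sum_j c j * (conv l u v : 'rV[R]_n) 0 j =
   l%:num * (\sum_j c j * u 0 j) + (1 - l%:num) * (\sum_j c j * v 0 j).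
  rewrite !mulr_sumr -big_split; apply: eq_bigr => j _ /=.
  rewrite !mxE /= /unstable.onem; move: (l%:num) (u 0 j) (v 0 j) => a p q; ring.
nra.
Qed.

Lemma interior_margin (A : set 'rV[R]_n) (x : 'rV[R]_n) : interior A x ->
  exists2 eps : R, 0 < eps & A (\row_j (x 0 j + eps)).
Proof.
move=> /nbhs_ballP[e /= e0 Ae]; exists (e / 2); first by rewrite divr_gt0.
apply: Ae; split => // i j; rewrite !mxE ord1 /ball /= opprD addNKr.
by rewrite normrN gtr0_norm ?divr_gt0 //; rewrite ltr_pdivrMr // ltr_pMr // ltr1n.
Qed.

End Capacity.

(** * MaxWeight on a sample path *)

Section MaxWeight.
Context (d dU : measure_display) (Om : measurableType d)
  (U : measurableType dU) (R : realType) (P : probability Om R) (n : nat).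
Variables (N : network R n) (X : inputs U P n)
  (pol : queue_vec n -> U -> queue_vec n) (lam : 'rV[R]_n).
Hypothesis hopen : open_switched_network N.
Hypothesis hbranching : pure_branching N.
Hypothesis hwork : same_mean_work N.
Hypothesis hlam : traffic_equations N lam.
Hypothesis hrho : capacity_region N (traffic_intensity N lam).
Hypothesis hpol : maxweight_policy N pol.

Let Z := queue_process X pol.
Let rho j := traffic_intensity N lam 0 j.

(** The maximal weight of a schedule, read off the choice of the policy; ties change the schedule
    but not its weight. *)
Definition max_weight (u : U) (q : queue_vec n) : nat := (\sum_j q j * pol q u j)%N.

Lemma max_weight_indep u u' q : max_weight u q = max_weight u' q.
Proof.
by apply/eqP; rewrite eqn_leq; apply/andP; split; apply: (policy_maxweight hpol);
   exact: (policy_feasible hpol).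
Qed.

Definition potential (u : U) (q : queue_vec n) : R :=
  (max_weight u q)%:R - \sum_j rho j * (q j)%:R.

(** The vector [rho] raised by [eps] in every coordinate is still in the hull of the schedules,
    where the linear functional [q] is at most the maximal weight. *)
Lemma capacity_margin : exists2 eps : R, 0 < eps & forall u (q : queue_vec n),
  eps * \sum_j (q j)%:R <= potential u q.
Proof.
have [eps eps0 hull] := interior_margin hrho.
exists eps => // u q.
have := @convex_hull_linear_le _ _ _ (fun j => (q j)%:R) (max_weight u q)%:R _ _ hull.
rewrite (eq_bigr (fun j => rho j * (q j)%:R + eps * (q j)%:R)) => [|j _]; last first.
  by rewrite mxE -/(rho j) mulrDr mulrC [eps * _]mulrC.
rewrite big_split /= -mulr_sumr /potential => H.
rewrite lerBrDl; apply: H => y [s Ss <-].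
rewrite (eq_bigr (fun j => (q j * s j)%N%:R)) => [|j _]; last by rewrite mxE natrM.
by rewrite -natr_sum ler_nat; exact: (policy_maxweight hpol).
Qed.

Lemma traffic_intensity_ge0 j : 0 <= rho j.
Proof.
have hull : convex_hull [set \row_j (s j)%:R | s in schedules N]
    (traffic_intensity N lam).
  exact: interior_subset hrho.
have := @convex_hull_linear_le _ _ _ (fun i => - (i == j)%:R) 0 _ _ hull.
rewrite (bigD1 j) //= eqxx big1 ?addr0 => [|i /negbTE ->]; last by rewrite oppr0 mul0r.
rewrite mulN1r oppr_le0; apply => _ [s Ss <-].
by apply: sumr_le0 => i _; rewrite mxE mulNr oppr_le0 mulr_ge0.
Qed.

Lemma common_completion_prob : exists2 p : R, 0 < p <= 1 &
  forall j, completion_prob N 0 j = p.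
Proof.
have [[j _]|no] := pselect (exists j : 'I_n, True).
  exists (completion_prob N 0 j) => [|i]; first exact: completion_prob_itv.
  exact: hwork.
(* Without queues, 1 serves as the common parameter. *)
by exists 1 => [|j]; [rewrite ltr01 lexx | case: no; exists j].
Qed.

Lemma schedules_bounded : exists M : nat,
  forall (s : queue_vec n) j, schedules N s -> (s j <= M)%N.
Proof.
have /finite_fsetP [F FE] := schedules_finite hopen.
exists (\sum_(s <- F) \sum_j s j)%N => s j; rewrite FE /= => sF.
by rewrite (big_fsetD1 s) //= (bigD1 j) //= -addnA leq_addr.
Qed.

Lemma routing_itv i j : 0 <= routing N i j <= 1.
Proof.
rewrite (routing_ge0 hopen) /=; apply: le_trans (routing_le1 hopen i).
by rewrite (bigD1 j) //= lerDl sumr_ge0 // => k _; exact: (routing_ge0 hopen).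
Qed.

Lemma routing_branching j i k : i != k -> routing N i j * routing N k j = 0.
Proof.
move=> ik; have [->|[[i0 [_ uniq]] _]] := hbranching j; first by rewrite mul0r.
have zero l : l != i0 -> routing N l j = 0.
  move=> li; apply/eqP; rewrite eq_le (routing_ge0 hopen) andbT leNgt.
  by apply/negP => /uniq li0; rewrite li0 eqxx in li.
have [ii0|/zero ->] := eqVneq i i0; last by rewrite mul0r.
by rewrite (zero k) ?mulr0 // -ii0 eq_sym.
Qed.

Section Path.
Variables (p : R) (M : nat).
Hypothesis p_itv : 0 < p <= 1.
Hypothesis hp : forall j, completion_prob N 0 j = p.
Hypothesis hM : forall (s : queue_vec n) j, schedules N s -> (s j <= M)%N.

(** One constant for three bounds: [M] for the service rates, [n * M ^ 2] for the weight lost by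
    truncating schedules, and the sum for [rho]. *)
Definition rate_bound : R := M%:R + n%:R * M%:R ^+ 2 + \sum_j rho j.
Let K := rate_bound.

Lemma rate_bound_ge0 : 0 <= K.
Proof.
rewrite !addr_ge0 ?mulr_ge0 ?sqr_ge0 // sumr_ge0 // => j _.
exact: traffic_intensity_ge0.
Qed.

Lemma traffic_intensity_itv j : 0 <= rho j <= K.
Proof.
rewrite traffic_intensity_ge0 /K /rate_bound /= (bigD1 j) //=.
rewrite addrCA lerDl !addr_ge0 ?mulr_ge0 ?sqr_ge0 ?sumr_ge0 // => i _.
exact: traffic_intensity_ge0.
Qed.

Variables (x : queue_vec n) (w : Om) (T : nat) (eta : R).
Hypothesis eta_ge0 : 0 <= eta.
Hypothesis noise : forall i k, (k <= M.+1 * T)%N -> network_deviation N X i k w <= eta.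

Let e t j : R := (minn (pol (Z x t w) (seed X t w) j) (Z x t w j))%:R.
Let Q t j : R := (Z x t w j)%:R.
Let h t : R := (max_weight (seed X t w) (Z x t w))%:R.

Lemma path_feasible t t' : \sum_j e t j * Q t' j <= h t'.
Proof.
rewrite (eq_bigr (fun j =>
    (Z x t' w j * minn (pol (Z x t w) (seed X t w) j) (Z x t w j))%N%:R)).
  rewrite -natr_sum ler_nat.
  pose s : queue_vec n := [ffun j => minn (pol (Z x t w) (seed X t w) j) (Z x t w j)].
  have sE j : s j = minn (pol (Z x t w) (seed X t w) j) (Z x t w j).
    by rewrite [LHS]ffunE.
  rewrite (eq_bigr (fun j => Z x t' w j * s j)%N) => [|j _]; last by rewrite sE.
  apply: (policy_maxweight hpol).
  apply: (schedules_monotone hopen (policy_feasible hpol (Z x t w) (seed X t w))) => j.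
  by rewrite sE geq_minl.
by move=> j _; rewrite /e /Q mulrC natrM.
Qed.

(** Service falls short of the schedule only at queues shorter than [M], each losing a weight of at
    most [M ^ 2]. *)
Lemma path_maximal t : h t <= \sum_j e t j * Q t j + K.
Proof.
rewrite (eq_bigr (fun j =>
    (minn (pol (Z x t w) (seed X t w) j) (Z x t w j) * Z x t w j)%N%:R)).
  apply: (@le_trans _ _
    ((\sum_j minn (pol (Z x t w) (seed X t w) j) (Z x t w j) * Z x t w j)%N +
      n * M ^ 2)%N%:R).
    rewrite ler_nat -[n in (n * _)%N]card_ord -sum_nat_const -big_split /=.
    apply: leq_sum => j _.
    have := hM j (policy_feasible hpol (Z x t w) (seed X t w)).
    move: (pol _ _ j) (Z x t w j) => a b aM.
    have [ab|/ltnW ba] := leqP a b; first by rewrite mulnC leq_addr.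
    apply: leq_trans (leq_addl _ _); rewrite expnS expn1 leq_mul //.
    exact: leq_trans aM.
  rewrite natrD natr_sum lerD2l natrM natrX /K /rate_bound.
  have S0 : 0 <= \sum_j rho j by apply: sumr_ge0 => j _; exact: traffic_intensity_ge0.
  by rewrite [leRHS]addrAC [leRHS]addrC lerDl addr_ge0.
by move=> j _; rewrite natrM.
Qed.

Lemma path_rate_itv t j : 0 <= e t j <= K.
Proof.
rewrite /e ler0n /= /K /rate_bound -addrA.
apply: (@le_trans _ _ M%:R).
  by rewrite ler_nat (leq_trans (geq_minl _ _)) // hM //; exact: (policy_feasible hpol).
rewrite lerDl addr_ge0 ?mulr_ge0 ?sqr_ge0 // sumr_ge0 // => i _.
exact: traffic_intensity_ge0.
Qed.

Lemma path_service_le t j : (service X pol x t w j <= M * t)%N.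
Proof.
rewrite service_sum -[t in (M * t)%N]card_ord mulnC -sum_nat_const.
apply: leq_sum => s _; apply: leq_trans (geq_minl _ _) _.
by apply: hM; exact: (policy_feasible hpol).
Qed.

(** Counts are replaced by their means at cost [eta] each: arrivals and completions at [j], then
    completions and routing for each queue i, hence 2 n + 2. The traffic equations absorb the
    arrivals into the drift of the excess. *)
Lemma path_drift t j : (t <= T)%N ->
  `|Q t j - (Q 0%N j + drift p (routing N) (excess rho e t) j)| <= (2 * n%:R + 2) * eta.
Proof.
move=> tT.
pose D i := departures X pol x t w i; pose V i := service X pol x t w i.
have VT i : (V i <= M.+1 * T)%N.
  apply: leq_trans (path_service_le t i) _; apply: leq_mul => //; exact: leqnSn.
have DV i : (D i <= V i)%N.
  rewrite /D /departures ffunE -/(V i) /completions -[leqRHS]card_ord -sum1_card.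
  by apply: leq_sum => k _; exact: leq_b1.
have nE : `|(external_arrivals X j t w)%:R - arrival_rate N 0 j * t%:R| <= eta.
  by apply: (noise (inl (inl j))); rewrite (leq_trans tT) // leq_pmull.
have nS i : `|(D i)%:R - p * (V i)%:R| <= eta.
  rewrite -(hp i) /D /departures ffunE -/(V i).
  exact: (noise (inl (inr i)) (VT i)).
have nR i : `|(routed_jobs X i j (D i) w)%:R - routing N i j * (D i)%:R| <= eta.
  exact: (noise (inr (i, j)) (leq_trans (DV i) (VT i))).
have bal : Q t j + (D j)%:R = Q 0%N j + ((external_arrivals X j t w)%:R +
     \sum_i (routed_jobs X i j (D i) w)%:R).
  rewrite /Q [Z x 0 w]queue_process0 -natr_sum -!natrD; congr _%:R.
  exact: queue_balance.
have excE i : excess rho e t i = (V i)%:R - rho i * t%:R.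
  rewrite /excess sumrB sumr_const card_ord mulr_natr; congr (_ - _).
  by rewrite /V service_sum natr_sum.
have lamE i : lam 0 i = p * rho i.
  rewrite /rho /traffic_intensity mxE hp mulrCA mulfV ?mulr1 // gt_eqF //.
  by case/andP: p_itv.
have driftE : drift p (routing N) (excess rho e t) j =
   \sum_i routing N i j * (p * (V i)%:R) - p * (V j)%:R + arrival_rate N 0 j * t%:R.
  have aE : arrival_rate N 0 j = p * rho j - \sum_i p * rho i * routing N i j.
    apply/eqP; rewrite eq_sym subr_eq -lamE (hlam j); apply/eqP; congr (_ + _).
    by apply: eq_bigr => i _; rewrite lamE.
  rewrite /drift aE mulrBl mulr_suml excE mulrBr mulr_sumr.
  rewrite (eq_bigr (fun i => routing N i j * (p * (V i)%:R) -
     p * rho i * routing N i j * t%:R)) => [|i _]; last by rewrite excE; ring.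
  by rewrite sumrB; ring.
have rt i : 0 <= routing N i j <= 1 := routing_itv i j.
have nRS : `|\sum_i ((routed_jobs X i j (D i) w)%:R - routing N i j * (p * (V i)%:R))|
    <= 2 * n%:R * eta.
  apply: le_trans (ler_norm_sum _ _ _) _.
  rewrite mulrAC mulr_natr -[n in _ *+ n]card_ord -sumr_const; apply: ler_sum => i _.
  have -> : (routed_jobs X i j (D i) w)%:R - routing N i j * (p * (V i)%:R) =
     ((routed_jobs X i j (D i) w)%:R - routing N i j * (D i)%:R) +
     routing N i j * ((D i)%:R - p * (V i)%:R) by ring.
  apply: le_trans (ler_normD _ _) _; rewrite mulr_natl mulr2n lerD // normrM.
  case/andP: (rt i) => r0 r1; rewrite (ger0_norm r0) -[leRHS]mul1r.
  exact: ler_pM.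
have := nS j; move: nE nRS; rewrite driftE sumrB !ler_norml.
move: bal; set B := \sum_i _; set B' := \sum_i _; move: (Q t j) (Q 0%N j) => q q'.
move: (_%:R) (p * _) (_%:R) (_ * t%:R) => v1 v2 v3 v4.
move=> bal /andP[? ?] /andP[? ?] /andP[? ?]; apply/andP; split; lra.
Qed.

Let eta' := (2 * n%:R + 2) * eta.

Let eta'_ge0 : 0 <= eta'.
Proof. by rewrite mulr_ge0 ?addr_ge0 ?mulr_ge0. Qed.

Let p_itv' : 0 <= p <= 1.
Proof. by case/andP: p_itv => /ltW ->. Qed.

Let path_potential u t :
  potential u (Z x t w) = h t - \sum_j rho j * Q t j.
Proof. by rewrite /potential (max_weight_indep u (seed X t w)). Qed.

(** A crude bound valid from every state, used for the finite mean that Foster's criterion asks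
    for. *)
Lemma potential_path_growth u : potential u (Z x T w) <=
  K * (\sum_j (x j)%:R + n%:R * ((n%:R + 1) * (K * T%:R) + 2 * eta')) + K.
Proof.
rewrite path_potential; apply: (@le_trans _ _ (h T)).
  rewrite gerBl sumr_ge0 // => j _; rewrite mulr_ge0 //.
  exact: traffic_intensity_ge0.
apply: le_trans (path_maximal T) _; rewrite lerD2r.
have -> : n%:R * ((n%:R + 1) * (K * T%:R) + 2 * eta') =
    \sum_(j < n) ((n%:R + 1) * (K * T%:R) + 2 * eta').
  by rewrite sumr_const card_ord mulr_natl.
rewrite -big_split mulr_sumr; apply: ler_sum => j _ /=.
have /andP[e0 eK] := path_rate_itv T j.
apply: ler_pM => //.
have := @queue_lip _ _ p (routing N) rho K p_itv' routing_itv traffic_intensity_itv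
  e Q T eta' path_rate_itv path_drift 0 T j (leqnn _).
by rewrite add0n /Q [Z x 0 w]queue_process0 ler_norml => /andP[_]; rewrite lerBlDl.
Qed.

Lemma potential_descent u (mu : R) (g m k : nat) (delta eps : R) :
  0 <= mu ->
  (forall y : 'I_n -> R,
     \sum_j y j * drift p (routing N) y j <= - mu * \sum_j y j ^+ 2) ->
  T = (m * g.+1 ^ k)%N -> (0 < m)%N -> (0 < k)%N -> 0 < delta -> 0 < eps ->
  0 < \sum_j (x j)%:R :> R -> eps * \sum_j (x j)%:R <= potential u x ->
  potential u (Z x T w) - potential u x <= T%:R * (- mu * (eps ^+ 2 -
      2 * eps * (block_cost n K * (T%:R + eta' + 1)) / \sum_j (x j)%:R) +
    (n%:R + 1) * K * (n%:R * delta) + block_cost n K / g.+1%:R +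
    block_cost n K * (eta' + 1) / m%:R +
    (n%:R + 1) * K * (g.+1%:R / delta) * (n%:R * K ^+ 2) / k%:R).
Proof.
move=> mu0 neg TE m0 k0 delta0 eps0.
have xE : \sum_j (x j)%:R = \sum_j Q 0%N j.
  by apply: eq_bigr => j _; rewrite /Q [Z x 0 w]queue_process0.
have xP : potential u x = h 0%N - \sum_j rho j * Q 0%N j.
  by rewrite -(path_potential u) [Z x 0 w]queue_process0.
rewrite path_potential xP xE => X0 Xe.
apply: (@trajectory_descent _ _ p (routing N) rho mu K p_itv' routing_itv
  traffic_intensity_itv rate_bound_ge0 mu0 neg e Q h T eta' path_rate_itv
  path_feasible path_maximal eta'_ge0 path_drift) => //.
Qed.

End Path.

(** Keeping [A] on the left while integrating makes both integrands nonnegative. *)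
Lemma integral_affine_le (F eta : Om -> R) (A a b H : R) :
  measurable_fun setT F -> measurable_fun setT eta -> (forall w, 0 <= F w) ->
  (forall w, 0 <= eta w) -> 0 <= A -> 0 <= a -> 0 <= b ->
  (forall w, F w + A <= a + b * eta w) ->
  (\int[P]_w (eta w)%:E <= H%:E)%E ->
  (\int[P]_w (F w)%:E <= (a + b * H - A)%:E)%E.
Proof.
move=> mF meta F0 eta0 A0 a0 b0 le HH.
have cstE (c : R) : (\int[P]_w c%:E = c%:E)%E.
  rewrite integral_cst // -[RHS]mule1; congr (_ * _)%E; exact: probability_setT.
have mFE : measurable_fun setT (fun w => (F w)%:E) by exact/measurable_EFinP.
have metaE : measurable_fun setT (fun w => (eta w)%:E) by exact/measurable_EFinP.
have F0E w : setT w -> (0 <= (F w)%:E)%E by rewrite lee_fin.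
have eta0E w : setT w -> (0 <= (eta w)%:E)%E by rewrite lee_fin.
have A0E w : @setT Om w -> (0 <= A%:E)%E by rewrite lee_fin.
have a0E w : @setT Om w -> (0 <= a%:E)%E by rewrite lee_fin.
have b0E : (0 <= b%:E)%E by rewrite lee_fin.
have bm : measurable_fun setT (fun w => b%:E * (eta w)%:E)%E.
  exact: emeasurable_funM.
have b0w w : setT w -> (0 <= b%:E * (eta w)%:E)%E by move=> _; rewrite mule_ge0 ?lee_fin.
have mc (c : R) : measurable_fun [set: Om] (fun=> c%:E) by exact: measurable_cst.
rewrite EFinB leeBrDr // -[X in (_ + X)%E]cstE.
rewrite -(ge0_integralD P measurableT F0E mFE A0E (mc A)).
apply: (@le_trans _ _ (\int[P]_w (a%:E + b%:E * (eta w)%:E))%E).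
  apply: ge0_le_integral => //.
  - by move=> w _; rewrite adde_ge0 // lee_fin.
  - exact: emeasurable_funD.
  - exact: emeasurable_funD.
  - by move=> w _; rewrite -EFinM -!EFinD lee_fin.
rewrite (ge0_integralD P measurableT a0E (mc a) b0w bm) cstE EFinD leeD2l //.
rewrite (ge0_integralZl P measurableT metaE eta0E b0E) EFinM.
exact: lee_wpmul2l.
Qed.

Lemma finite_population_le (L : nat) :
  finite_set [set q : queue_vec n | (\sum_j q j <= L)%N].
Proof.
apply: (@sub_finite_set _ _
  (range (fun f : {ffun 'I_n -> 'I_L.+1} => [ffun j => f j : nat] : queue_vec n))).
  move=> q /= qL; exists [ffun j => inord (q j)] => //.
  apply/ffunP => j; rewrite !ffunE inordK // ltnS; apply: leq_trans qL.
  by rewrite (bigD1 j) //= leq_addr.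
by apply: finite_image; exact: finite_finset.
Qed.

End MaxWeight.

(** * Choice of the constants and conclusion *)

Lemma small_inverse (R : realType) (a b : R) : 0 <= a -> 0 < b ->
  exists m0 : nat, (0 < m0)%N /\ forall m, (m0 <= m)%N -> a / m%:R <= b.
Proof.
move=> a0 b0; exists (Num.truncn (a / b)).+1; split=> // m m0m.
have m_gt0 : 0 < m%:R :> R by rewrite ltr0n (leq_trans _ m0m).
rewrite ler_pdivrMr // -ler_pdivrMl // mulrC; apply: le_trans (ltW (truncnS_gt _)) _.
by rewrite ler_nat.
Qed.

(** The constants are fixed in the order [delta], [g], [k], [e1], [m], [l0]. With [16 * b] the ideal
    descent rate, each of six errors is brought below [b]. *)
Theorem theorem4 (R : realType) (n : nat) (N : network R n)
    (hopen : open_switched_network N)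
    (hbranching : pure_branching N)
    (hwork : same_mean_work N)
    (lam : 'rV[R]_n) (hlam : traffic_equations N lam)
    (hrho : capacity_region N (traffic_intensity N lam))
    (d dU : measure_display) (Om : measurableType d) (U : measurableType dU)
    (P : probability Om R) (X : inputs U P n) (hX : inputs_law N X)
    (pol : queue_vec n -> U -> queue_vec n)
    (hpol : maxweight_policy N pol) :
  positive_recurrent P (queue_process X pol).
Proof.
have [p p_itv hp] := common_completion_prob hopen hwork.
have [M hM] := schedules_bounded hopen.
have [mu mu0 neg] : exists2 mu, 0 < mu & forall y : 'I_n -> R,
    \sum_j y j * drift p (routing N) y j <= - mu * \sum_j y j ^+ 2.
  apply: drift_negative_definite.
  - by case/andP: p_itv.
  - exact: routing_ge0.
  - exact: routing_le1.
  - exact: routing_open.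
  - exact: (routing_branching hopen hbranching).
have [eps eps0 Veps] := capacity_margin hrho hpol.
(* A probability space has a point, which supplies a seed for naming the potential. *)
have [w0 _] : [set: Om] !=set0.
  apply/set0P/negP => /eqP E; have P1 : P setT = 1%E by exact: probability_setT.
  by move: P1; rewrite E measure0 => /esym/eqP; rewrite onee_eq0.
pose u0 := seed X 0%N w0.
pose Z := queue_process X pol; pose V := potential N pol lam u0.
have [K KE] : exists K, rate_bound N lam M = K by exists (rate_bound N lam M).
have K0 : 0 <= K by rewrite -KE; exact: (rate_bound_ge0 hrho).
have [bc bcE] : exists bc, block_cost n K = bc by exists (block_cost n K).
have bc0 : 0 <= bc by rewrite -bcE; exact: block_cost_ge0.
have HZ : markov_family P Z := queue_process_markov hX hpol.
have V0 q : 0 <= V q.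
  by apply: le_trans (Veps u0 q); rewrite mulr_ge0 ?(ltW eps0) // sumr_ge0.
have [b b0 bE] : exists2 b, 0 < b & mu * eps ^+ 2 = 16 * b.
  exists (mu * eps ^+ 2 / 16); first by rewrite divr_gt0 // mulr_gt0 // exprn_gt0.
  by field.
have budget (a : R) : 0 <= a -> a * (b / (a + 1)) <= b.
  move=> a0; rewrite mulrCA; apply: ler_piMr; first exact: ltW.
  by rewrite ler_pdivrMr ?mul1r ?lerDl // ltr_wpDl.
pose a1 := (n%:R + 1) * K * n%:R.
have a1_ge0 : 0 <= a1 by rewrite !mulr_ge0 ?addr_ge0.
pose delta := b / (a1 + 1).
have delta0 : 0 < delta by rewrite divr_gt0 // ltr_wpDl.
have [g [_ Hg]] := small_inverse bc0 b0.
pose a2 := (n%:R + 1) * K * (g.+1%:R / delta) * (n%:R * K ^+ 2).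
have a2_ge0 : 0 <= a2.
  by rewrite !mulr_ge0 ?addr_ge0 ?sqr_ge0 // invr_ge0 ltW.
have [k [k0 Hk]] := small_inverse a2_ge0 b0.
pose C1 : R := 2 * n%:R + 2.
have C1_ge0 : 0 <= C1 by rewrite addr_ge0 ?mulr_ge0.
(* The horizon is [m] times [g.+1 ^ k], so [m] cancels in the noise cost at the smallest scale; the
   precision [e1] can thus be chosen before [m]. *)
pose a3 := bc * C1 * (M.+1 * g.+1 ^ k)%N%:R.
have a3_ge0 : 0 <= a3 by rewrite !mulr_ge0.
have [e1 e1_gt0 a3e1] : exists2 e1, 0 < e1 & a3 * e1 <= b.
  exists (b / (a3 + 1)); last exact: budget.
  by rewrite divr_gt0 // ltr_wpDl.
have [N0 HN0] := network_noise hX e1_gt0.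
have [m1 [m10 Hm1]] := small_inverse bc0 b0.
(* [N0] makes the horizon long enough for the law of large numbers, [m1] makes [bc / m] small. *)
pose m := maxn N0 m1.
have m0 : (0 < m)%N by rewrite (leq_trans m10) // leq_maxr.
have mR : 0 < m%:R :> R by rewrite ltr0n.
pose T := (m * g.+1 ^ k)%N.
have T0 : (0 < T)%N by rewrite muln_gt0 m0 expn_gt0.
have TR : 0 < T%:R :> R by rewrite ltr0n.
have [|eta [meta eta0 noise Eeta]] := HN0 (M.+1 * T)%N.
  apply: (@leq_trans m); first exact: leq_maxl.
  by rewrite /T mulnCA leq_pmulr // muln_gt0 expn_gt0.
set H := e1 * _ in Eeta.
have H0 : 0 <= H by rewrite mulr_ge0 // ltW.
have noise_m : bc * C1 / m%:R * H <= b.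
  have -> : bc * C1 / m%:R * H = a3 * e1.
    by rewrite /H /a3 /T !natrM; field; rewrite gt_eqF.
  exact: a3e1.
(* This error grows with [T] but is divided by the total queue length, so the threshold [l0] comes
   last. *)
pose a4 := 2 * mu * eps * bc * (T%:R + 1 + C1 * H).
have a4_ge0 : 0 <= a4.
  by rewrite !mulr_ge0 ?addr_ge0 ?mulr_ge0 // ltW.
have [l0 [l00 Hl0]] := small_inverse a4_ge0 b0.
have mF x : measurable_fun setT (fun w => V (Z x T w)).
  exact: (discrete_measurable_fun V (markov_measurable HZ x T)).
(* Scales a decrease of [8 * b * T] to the unit decrease of Foster's criterion. *)
pose sc := (8 * b * T%:R)^-1.
have sc0 : 0 < sc by rewrite invr_gt0 !mulr_gt0.
have scE x : (\int[P]_w (sc * V (Z x T w))%:E = sc%:E * \int[P]_w (V (Z x T w))%:E)%E.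
  under eq_integral do rewrite EFinM.
  rewrite ge0_integralZl //.
  - exact/measurable_EFinP.
  - by move=> w _; rewrite lee_fin.
  - by rewrite lee_fin ltW.
apply: (foster_criterion HZ (V := fun q => sc * V q) T0 (finite_population_le n l0)).
- by move=> q; rewrite mulr_ge0 // ltW.
- move=> x; rewrite scE.
  have := @integral_affine_le _ _ _ P (fun w => V (Z x T w)) eta 0
    (K * (\sum_j (x j)%:R + n%:R * ((n%:R + 1) * (K * T%:R))) + K)
    (K * (n%:R * (2 * C1))) H (mF x) meta _ eta0 (lexx _) _ _ _ Eeta.
  move=> /(_ (fun w => V0 _)) le.
  apply: (@le_lt_trans _ _ (sc%:E *
    ((K * (\sum_j (x j)%:R + n%:R * ((n%:R + 1) * (K * T%:R))) + K) + K * (n%:R * (2 * C1)) * H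
     - 0)%:E)%E); last by rewrite -EFinM ltry.
  apply: lee_wpmul2l; first by rewrite lee_fin ltW.
  apply: le.
  + by rewrite !(addr_ge0, mulr_ge0) // sumr_ge0.
  + by rewrite !mulr_ge0.
  + move=> w; rewrite addr0 /=.
    have := @potential_path_growth _ _ _ _ _ P _ _ X _ _ hopen hlam hrho hpol p M
      p_itv hp hM x w T (eta w) (fun i k kT => noise i w k kT) u0.
    by rewrite KE -/C1 -/V -/Z => /le_trans; apply; lra.
move=> x /negP; rewrite -ltnNge => xl.
pose Y : R := \sum_j (x j)%:R.
have YE : Y = (\sum_j x j)%N%:R by rewrite natr_sum.
have Y0 : 0 < Y by rewrite YE ltr0n (leq_trans l00) // ltnW.
have HY : a4 / Y <= b by rewrite YE; apply: Hl0; exact: ltnW.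
(* [alpha] gathers the errors free of noise, [beta] the coefficient of [eta]. *)
pose alpha := 2 * mu * eps * bc * (T%:R + 1) / Y + a1 * delta + bc / g.+1%:R +
  bc / m%:R + a2 / k%:R.
pose beta := 2 * mu * eps * bc * C1 / Y + bc * C1 / m%:R.
have ltW' (r : R) : 0 < r -> 0 <= r by exact: ltW.
have [mu_ge0 eps_ge0 delta_ge0 Y_ge0] : [/\ 0 <= mu, 0 <= eps, 0 <= delta & 0 <= Y].
  by split; exact: ltW'.
have [c1 c1_ge0 c1E] : exists2 c1, 0 <= c1 & 2 * mu * eps * bc / Y = c1.
  by exists (2 * mu * eps * bc / Y) => //; rewrite !(divr_ge0, mulr_ge0).
have alpha0 : 0 <= alpha.
  rewrite /alpha; do !apply: addr_ge0; try exact: divr_ge0.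
    by rewrite mulrAC c1E mulr_ge0 // addr_ge0.
  exact: mulr_ge0.
have beta0 : 0 <= beta.
  rewrite /beta mulrAC c1E addr_ge0 //; first exact: mulr_ge0.
  by apply: divr_ge0 => //; exact: mulr_ge0.
have path w : V (Z x T w) + T%:R * (16 * b) <= V x + T%:R * alpha + T%:R * beta * eta w.
  have := @potential_descent _ _ _ _ _ P _ _ X _ _ hopen hlam hrho hpol p M p_itv hp hM
    x w T (eta w) (eta0 w) (fun i k kT => noise i w k kT) u0 mu g m k delta eps
    (ltW mu0) neg erefl m0 k0 delta0 eps0 Y0 (Veps u0 x).
  rewrite -/V -/Z KE bcE -/C1 -/Y -bE lerBlDl => /le_trans.
  rewrite -lerBrDr; apply.
  rewrite /alpha /beta /a1 /a2.
  move: (Y^-1) (m%:R^-1) (k%:R^-1) (g.+1%:R / delta) (bc / g.+1%:R) (eta w).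
  move=> y1 m' k' gd bg e.
  lra.
have le := @integral_affine_le _ _ _ P (fun w => V (Z x T w)) eta (T%:R * (16 * b))
    (V x + T%:R * alpha) (T%:R * beta) H (mF x) meta (fun w => V0 _) eta0 _ _ _ path Eeta.
have Ta : 0 <= T%:R * alpha by rewrite mulr_ge0.
have small : alpha + beta * H <= 6 * b.
  have le1 : 2 * mu * eps * bc * (T%:R + 1) / Y + 2 * mu * eps * bc * C1 / Y * H <= b.
    apply: le_trans HY; rewrite /a4; move: (Y^-1) => y1; lra.
  have le2 : a1 * delta <= b by exact: budget.
  have le3 : bc / g.+1%:R <= b by apply: Hg.
  have le4 : bc / m%:R <= b by apply: Hm1; exact: leq_maxr.
  have le5 : a2 / k%:R <= b by apply: Hk.
  apply: (@le_trans _ _ (b + b + b + b + b + b)); last by lra.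
  apply: le_trans (lerD (lerD (lerD (lerD (lerD le1 le2) le3) le4) le5) noise_m).
  rewrite le_eqVlt; apply/orP; left; apply/eqP; rewrite /alpha /beta.
  move: (Y^-1) (m%:R^-1) (bc / g.+1%:R) (a2 / k%:R) (a1 * delta) => y1 m' bg ak ad.
  ring.
rewrite scE -leeBrDr //.
apply: (@le_trans _ _ (sc%:E * (V x - 8 * b * T%:R)%:E)%E).
  apply: lee_wpmul2l; first by rewrite lee_fin ltW.
  apply: le_trans (le _ _ _) _.
  - by rewrite !mulr_ge0 // ltW.
  - by rewrite addr_ge0.
  - by rewrite mulr_ge0.
  rewrite lee_fin; have := ler_wpM2l (ltW TR) small.
  have := mulr_gt0 b0 TR; lra.
rewrite -EFinM -EFinB lee_fin mulrBr /sc mulVf // gt_eqF //.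
by rewrite !mulr_gt0.
Qed.
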